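(* Let $\mathbb F$ be an algebraically closed field of characteristic different from $2$. (a) Every pair $(A,B)$ of skew-symmetric matrices over $\mathbb F$ of the same size is congruent to a direct sum, determined uniquely up to permutation of summands, of pairs $(X,Y)$ of skew-symmetric tridiagonal matrices (with zero diagonals) of the following two types, where $k,n$ are positive integers and $\lambda\in\mathbb F$; each matrix is described by its superdiagonal entries $X_{j,j+1}=-X_{j+1,j}$ and $Y_{j,j+1}=-Y_{j+1,j}$, $j=1,2,\dots$: (i) size $2k$: the entries $X_{j,j+1}$ form the sequence $1,0,1,0,\dots$ and the entries $Y_{j,j+1}$ form the sequence $\lambda,1,\lambda,1,\dots$; (ii) size $n$: the entries $X_{j,j+1}$ form the sequence $0,1,0,1,\dots$ and the entries $Y_{j,j+1}$ form the sequence $1,0,1,0,\dots$. (b) This direct sum is determined uniquely up to permutation of summands by the Kronecker canonical form of $(A,B)$ under equivalence. The Kronecker canonical form of each of the direct summands is as follows: - type (i): $(I_k,J_k(\lambda))\oplus(I_k,J_k(\lambda))$; - type (ii): $(F_k,G_k)\oplus(F_k^T,G_k^T)$ if $n=2k+1$, and $(J_k(0),I_k)\oplus(J_k(0),I_k)$ if $n=2k$.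
   Context: Matrix pairs $(A,B)$ and $(A',B')$ of square matrices are congruent if there is a nonsingular $S$ with $S^TAS=A'$ and $S^TBS=B'$. Matrix pairs $(A,B)$ and $(A',B')$ are equivalent if there are nonsingular $R,S$ with $RAS=A'$ and $RBS=B'$. Direct sums of pairs are taken componentwise: $(A,B)\oplus(A',B')=(A\oplus A',B\oplus B')$. $I_n$ is the $n\times n$ identity matrix and $J_n(\lambda)$ is the $n\times n$ upper triangular Jordan block with eigenvalue $\lambda$ (ones on the superdiagonal). For $n\ge 0$, $F_n$ and $G_n$ are the $n\times(n+1)$ matrices $F_n=[\,I_n\ |\ 0\,]$ (identity followed by a zero column) and $G_n=[\,0\ |\ I_n\,]$ (zero column followed by the identity); $F_0=G_0$ is the $0\times 1$ matrix (taking a direct sum with it adjoins a zero column; with its transpose, a zero row). Kronecker's theorem: each pair of matrices of the same size is equivalent to a direct sum, determined uniquely up to permutation of summands, of pairs of the form $(I_n,J_n(\lambda))$, $(J_n(0),I_n)$, $(F_n,G_n)$, $(F_n^T,G_n^T)$; this direct sum is the Kronecker canonical form of the pair. *)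

(* Defs.v *)
From HB Require Import structures.
From mathcomp Require Import all_boot all_order all_algebra.

Set Implicit Arguments.
Unset Strict Implicit.
Unset Printing Implicit Defensive.

Import GRing.Theory.
Local Open Scope ring_scope.

Section Pairs.
Variable F : fieldType.

(* Sizes are bundled with the matrices, so that Leibniz equality of two pairs
   includes the equality of their sizes. *)
Record mxpair := MxPair {
  nrows : nat;
  ncols : nat;
  mxfst : 'M[F]_(nrows, ncols);
  mxsnd : 'M[F]_(nrows, ncols) }.

Record sqpair := SqPair {
  dim : nat;
  sqfst : 'M[F]_dim;
  sqsnd : 'M[F]_dim }.

Definition mxpair_of_sqpair (P : sqpair) : mxpair :=
  MxPair (sqfst P) (sqsnd P).

Definition equivalent (P Q : mxpair) : Prop :=
  exists (R : 'M[F]_(nrows P)) (S : 'M[F]_(ncols P)),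
    [/\ R \in unitmx, S \in unitmx
      & MxPair (R *m mxfst P *m S) (R *m mxsnd P *m S) = Q].

Definition congruent (P Q : sqpair) : Prop :=
  exists S : 'M[F]_(dim P),
    S \in unitmx /\
    SqPair (S^T *m sqfst P *m S) (S^T *m sqsnd P *m S) = Q.

Definition mxpair_dsum (P Q : mxpair) : mxpair :=
  MxPair (block_mx (mxfst P) 0 0 (mxfst Q)) (block_mx (mxsnd P) 0 0 (mxsnd Q)).

Definition sqpair_dsum (P Q : sqpair) : sqpair :=
  SqPair (block_mx (sqfst P) 0 0 (sqfst Q)) (block_mx (sqsnd P) 0 0 (sqsnd Q)).

(* The empty direct sum is the pair of 0 x 0 matrices. *)
Definition mxpair_dsums (s : seq mxpair) : mxpair :=
  foldr mxpair_dsum (MxPair (0 : 'M[F]_(0, 0)) 0) s.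

Definition sqpair_dsums (s : seq sqpair) : sqpair :=
  foldr sqpair_dsum (SqPair (0 : 'M[F]_0) 0) s.

End Pairs.

Coercion mxpair_of_sqpair : sqpair >-> mxpair.

Section Kronecker.
Variable F : fieldType.

Definition jordan_block (n : nat) (lambda : F) : 'M[F]_n :=
  \matrix_(i, j) (if i == j then lambda else (j == i.+1 :> nat)%:R).

Definition kron_F (n : nat) : 'M[F]_(n, n.+1) :=
  \matrix_(i, j) (j == i :> nat)%:R.

Definition kron_G (n : nat) : 'M[F]_(n, n.+1) :=
  \matrix_(i, j) (j == i.+1 :> nat)%:R.

Inductive kron_index : Type :=
  | KronIJ of nat & F
  | KronJI of nat
  | KronFG of nat
  | KronFGT of nat.

Definition kron_index_encode (b : kron_index) : (nat * F) + (nat + (nat + nat)) :=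
  match b with
  | KronIJ n lambda => inl (n, lambda)
  | KronJI n => inr (inl n)
  | KronFG n => inr (inr (inl n))
  | KronFGT n => inr (inr (inr n))
  end.

Definition kron_index_decode (c : (nat * F) + (nat + (nat + nat))) : kron_index :=
  match c with
  | inl (n, lambda) => KronIJ n lambda
  | inr (inl n) => KronJI n
  | inr (inr (inl n)) => KronFG n
  | inr (inr (inr n)) => KronFGT n
  end.

Lemma kron_index_encodeK : cancel kron_index_encode kron_index_decode.
Proof. by case. Qed.

HB.instance Definition _ :=
  Equality.copy kron_index (can_type kron_index_encodeK).

(* F_0 and G_0 are legitimate 0 x 1 summands. *)
Definition kron_index_valid (b : kron_index) : bool :=
  match b with
  | KronIJ n _ | KronJI n => (0 < n)%N
  | KronFG _ | KronFGT _ => true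
  end.

Definition kron_pair (b : kron_index) : mxpair F :=
  match b with
  | KronIJ n lambda => MxPair 1%:M (jordan_block n lambda)
  | KronJI n => MxPair (jordan_block n 0) 1%:M
  | KronFG n => MxPair (kron_F n) (kron_G n)
  | KronFGT n => MxPair (kron_F n)^T (kron_G n)^T
  end.

(* The list [c] is one ordering of the summands of the Kronecker canonical
   form, which is only defined up to [perm_eq]. *)
Definition kronecker_form (P : mxpair F) (c : seq kron_index) : Prop :=
  all kron_index_valid c /\ equivalent P (mxpair_dsums (map kron_pair c)).

End Kronecker.

Section SkewPairs.
Variable F : fieldType.

(* Since ordinals start at 0, [u i] is the superdiagonal entry in the
   1-based position (i + 1, i + 2); hence the first terms of the sequences
   in [skew_pair] are those with [i] even. *)
Definition skew_tridiag (n : nat) (u : nat -> F) : 'M[F]_n :=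
  \matrix_(i, j) (if j == i.+1 :> nat then u i
                  else if i == j.+1 :> nat then - u j
                  else 0).

Inductive skew_index : Type :=
  | SkewI of nat & F
  | SkewII of nat.

Definition skew_index_encode (b : skew_index) : (nat * F) + nat :=
  match b with
  | SkewI k lambda => inl (k, lambda)
  | SkewII n => inr n
  end.

Definition skew_index_decode (c : (nat * F) + nat) : skew_index :=
  match c with
  | inl (k, lambda) => SkewI k lambda
  | inr n => SkewII n
  end.

Lemma skew_index_encodeK : cancel skew_index_encode skew_index_decode.
Proof. by case. Qed.

HB.instance Definition _ :=
  Equality.copy skew_index (can_type skew_index_encodeK).

Definition skew_index_valid (b : skew_index) : bool :=
  match b with
  | SkewI k _ => (0 < k)%N
  | SkewII n => (0 < n)%N
  end.

Definition skew_pair (b : skew_index) : sqpair F :=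
  match b with
  | SkewI k lambda =>
      SqPair (skew_tridiag (2 * k) (fun i => if odd i then 0 else 1))
             (skew_tridiag (2 * k) (fun i => if odd i then 1 else lambda))
  | SkewII n =>
      SqPair (skew_tridiag n (fun i => if odd i then 1 else 0))
             (skew_tridiag n (fun i => if odd i then 0 else 1))
  end.

Definition skew_form (P : sqpair F) (s : seq skew_index) : Prop :=
  all skew_index_valid s /\ congruent P (sqpair_dsums (map skew_pair s)).

End SkewPairs.

(* Main.v *)
From HB Require Import structures.
Require Import Defs.
From mathcomp Require Import all_boot all_order all_algebra.
From mathcomp Require Import fingroup perm zify ring.

(** Existence, by induction on the size. If the pencil [A + tB] is singular, a
    polynomial null vector whose length cannot be reduced by passing to a
    solution of the dual system gives isotropic chains [U] and [W] spanning a
    summand of type (ii) of odd size, [W] being made isotropic by a correction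
    that halves its Gram matrix. If it is regular, a quotient of two members of
    the pencil is self-adjoint for both forms; by Fitting's lemma it is
    nilpotent unless the pair splits, and a Jordan chain [u f^i] of maximal
    length together with a dual chain [w f^i] spans a summand of type (i) or of
    type (ii) of even size.

    Uniqueness: the dimensions of [{X | A X P = B X Q}], for fixed test pairs
    [(P, Q)], are additive and invariant under equivalence, and the
    multiplicities of the summands are second differences of them. *)

Set Implicit Arguments.
Unset Strict Implicit.
Unset Printing Implicit Defensive.

Import GRing.Theory.
Local Open Scope ring_scope.

(** * Congruence and equivalence of pairs *)

(** Each normal form consists of two isotropic halves paired by one bidiagonal block, so its
    Kronecker form is that of the block together with that of its transpose: this is why Kronecker
    blocks occur in pairs. Only two blocks are ever built, a nilpotent and a singular one; other
    eigenvalues, and the exchange of the two matrices, are restored by linear combinations of the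
    two members, which congruence respects. In the singular case both forms are degenerate on a
    block of odd size, so neither orthogonal space is a complement; the complement is cut out by
    functionals ([L] in [congruent_split]) supplied by the dual chain. Kronecker's theorem is never
    proved: the test dimensions can be computed from any Kronecker form, so the same numbers serve
    uniqueness in (a) and the dependence on the Kronecker form in (b). Three families of tests
    occur, for finite eigenvalues, for the infinite one and for odd sizes. *)

Section PairRelations.
Variable F : fieldType.
Implicit Types P Q : sqpair F.
Implicit Types K L : mxpair F.

Lemma inverse_mx_dim m n (R : 'M[F]_(m, n)) (R' : 'M[F]_(n, m)) :
  R *m R' = 1%:M -> R' *m R = 1%:M -> m = n.
Proof.
move=> RR' R'R; apply/eqP.
by rewrite eqn_leq (mulmx1_min RR') (mulmx1_min R'R).
Qed.

(** Sizes are bundled and need not agree definitionally, so the base change becomes a rectangular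
    [E] (in the role of [S^T]) with a two-sided inverse, which avoids casts. *)
Lemma congruentP P Q :
  congruent P Q <->
  exists (E : 'M[F]_(Defs.dim Q, Defs.dim P)) (E' : 'M[F]_(Defs.dim P, Defs.dim Q)),
    [/\ E *m E' = 1%:M, E' *m E = 1%:M, E *m sqfst P *m E^T = sqfst Q
      & E *m sqsnd P *m E^T = sqsnd Q].
Proof.
split=> [[S [uS <-]] | [E [E']]] /=.
  exists S^T, (invmx S)^T; rewrite trmxK -!trmx_mul mulVmx // mulmxV // trmx1.
  by split.
case: P Q E E' => n A B [n' A' B'] /= E E' [EE' E'E eA eB].
have e := inverse_mx_dim EE' E'E; subst n'.
by exists E^T; rewrite unitmx_tr trmxK eA eB; case: (mulmx1_unit EE').
Qed.

Lemma equivalentP K L :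
  equivalent K L <->
  exists (R : 'M[F]_(nrows L, nrows K)) (R' : 'M[F]_(nrows K, nrows L))
         (S : 'M[F]_(ncols K, ncols L)) (S' : 'M[F]_(ncols L, ncols K)),
    [/\ R *m R' = 1%:M, R' *m R = 1%:M, S *m S' = 1%:M & S' *m S = 1%:M] /\
    (R *m mxfst K *m S = mxfst L /\ R *m mxsnd K *m S = mxsnd L).
Proof.
split=> [[R [S [uR uS <-]]] | [R [R' [S [S']]]]] /=.
  exists R, (invmx R), S, (invmx S).
  by rewrite !mulVmx // !mulmxV.
case: K L R R' S S' => p q A B [p' q' A' B'] /= R R' S S'.
case=> [[RR' R'R SS' S'S] [eA eB]].
have e := inverse_mx_dim RR' R'R; have e' := inverse_mx_dim SS' S'S.
subst p' q'; exists R, S; rewrite /= eA eB.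
by case: (mulmx1_unit RR') (mulmx1_unit SS') => -> _ [-> _].
Qed.

Lemma congruent_refl P : congruent P P.
Proof.
apply/congruentP; exists 1%:M, 1%:M.
by rewrite !mul1mx trmx1 !mulmx1.
Qed.

Lemma congruent_trans P Q T : congruent P Q -> congruent Q T -> congruent P T.
Proof.
move=> /congruentP [E [E' [EE' E'E eA eB]]] /congruentP [G [G' [GG' G'G eA' eB']]].
apply/congruentP; exists (G *m E), (E' *m G').
rewrite !mulmxA -(mulmxA G) EE' mulmx1 GG' -(mulmxA E') G'G mulmx1 E'E trmx_mul.
rewrite !mulmxA -!(mulmxA G) eA !(mulmxA G) eA'.
by rewrite -(mulmxA G E) -(mulmxA G (E *m _)) eB eB'.
Qed.

Lemma congruent_sym P Q : congruent P Q -> congruent Q P.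
Proof.
move=> /congruentP [E [E' [EE' E'E eA eB]]].
apply/congruentP; exists E', E; rewrite -eA -eB !mulmxA E'E !mul1mx.
by rewrite -!mulmxA -trmx_mul E'E trmx1 !mulmx1.
Qed.

Lemma congruent_dsum P P' Q Q' :
  congruent P Q -> congruent P' Q' ->
  congruent (sqpair_dsum P P') (sqpair_dsum Q Q').
Proof.
move=> /congruentP [E [E' [EE' E'E eA eB]]] /congruentP [G [G' [GG' G'G eA' eB']]].
apply/congruentP; exists (block_mx E 0 0 G), (block_mx E' 0 0 G').
rewrite /= !tr_block_mx !mulmx_block !trmx0.
rewrite !mul0mx !mulmx0 !add0r !addr0 !mul0mx EE' E'E GG' G'G.
by rewrite eA eB eA' eB' -!scalar_mx_block.
Qed.

Lemma equivalent_trans K L T : equivalent K L -> equivalent L T -> equivalent K T.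
Proof.
move=> /equivalentP [R [R' [S [S' [[RR' R'R SS' S'S] [eA eB]]]]]].
move=> /equivalentP [G [G' [H [H' [[GG' G'G HH' H'H] [eA' eB']]]]]].
apply/equivalentP; exists (G *m R), (R' *m G'), (S *m H), (H' *m S').
rewrite -eA' -eB' -eA -eB !mulmxA -(mulmxA G R) RR' mulmx1 GG'.
rewrite -(mulmxA R' G') G'G mulmx1 R'R.
by rewrite -(mulmxA S H) HH' mulmx1 SS' -(mulmxA H' S') S'S mulmx1 H'H.
Qed.

Lemma equivalent_dsum K K' L L' :
  equivalent K L -> equivalent K' L' ->
  equivalent (mxpair_dsum K K') (mxpair_dsum L L').
Proof.
move=> /equivalentP [R [R' [S [S' [[RR' R'R SS' S'S] [eA eB]]]]]].
move=> /equivalentP [G [G' [H [H' [[GG' G'G HH' H'H] [eA' eB']]]]]].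
apply/equivalentP; exists (block_mx R 0 0 G), (block_mx R' 0 0 G').
exists (block_mx S 0 0 H), (block_mx S' 0 0 H').
rewrite /= !mulmx_block.
rewrite !mul0mx !mulmx0 !add0r !addr0 !mul0mx RR' R'R SS' S'S GG' G'G HH' H'H.
by rewrite eA eB eA' eB' -!scalar_mx_block.
Qed.

Lemma congruent_equivalent P Q : congruent P Q -> equivalent P Q.
Proof.
case: P Q => n A B [n' A' B'] /congruentP /= [E [E' [EE' E'E eA eB]]].
apply/equivalentP; exists E, E', E^T, E'^T => /=; split; last by [].
by split; rewrite // -trmx_mul ?EE' ?E'E trmx1.
Qed.

Lemma mxpair_of_sqpair_dsums (s : seq (sqpair F)) :
  mxpair_of_sqpair (sqpair_dsums s) = mxpair_dsums (map (@mxpair_of_sqpair F) s).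
Proof.
elim: s => [|P s IH] //=; rewrite -IH //.
Qed.

Lemma sqpair_dsumA P Q T :
  sqpair_dsum P (sqpair_dsum Q T) = sqpair_dsum (sqpair_dsum P Q) T.
Proof.
case: P Q T => [a A A'] [b B B'] [c C C']; rewrite /sqpair_dsum /=.
rewrite -[X in block_mx A X](row_mx0 _ a b c) -[X in block_mx A _ X](col_mx0 _ b c a).
rewrite -[X in block_mx A' X](row_mx0 _ a b c) -[X in block_mx A' _ X](col_mx0 _ b c a).
rewrite !block_mxA !row_mx0 !col_mx0.
move: (esym (addnA a b c)) => e; move: (block_mx _ _ _ C) (block_mx _ _ _ C').
by move: (_ + _ + _)%N e => n e; subst n => X Y; rewrite !castmx_id.
Qed.

Lemma sqpair_dsums_cat (s t : seq (sqpair F)) :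
  sqpair_dsums (s ++ t) = sqpair_dsum (sqpair_dsums s) (sqpair_dsums t).
Proof.
elim: s => [|P s IH] /=; last by rewrite IH sqpair_dsumA.
case: (sqpair_dsums t) => n A B; have e (i : 'I_n) : rshift 0 i = i by exact: val_inj.
congr SqPair; apply/matrixP => i j.
  by have := block_mxEdr (0 : 'M[F]_0) 0 0 A i j; rewrite !e.
by have := block_mxEdr (0 : 'M[F]_0) 0 0 B i j; rewrite !e.
Qed.

End PairRelations.

(** * Skew pairs made of two isotropic halves *)

Section Interleaving.
Variable F : fieldType.

(** Gram matrix of a skew form on a space split into two isotropic halves, with [C] as their
    pairing. *)
Definition bipartite_mx p q (C : 'M[F]_(p, q)) : 'M[F]_(p + q) :=
  block_mx 0 C (- C^T) 0.

(* Listing the two isotropic halves alternately, starting with the first one,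
   turns a bidiagonal off-diagonal block into a tridiagonal matrix. *)
Lemma congruent_interleave p q (C D : 'M[F]_(p, q)) (u v : nat -> F) :
  (q <= p <= q.+1)%N ->
  (forall a b, C a b = if a == b :> nat then u a.*2
                       else if a == b.+1 :> nat then - u b.*2.+1 else 0) ->
  (forall a b, D a b = if a == b :> nat then v a.*2
                       else if a == b.+1 :> nat then - v b.*2.+1 else 0) ->
  congruent (SqPair (bipartite_mx C) (bipartite_mx D))
            (SqPair (skew_tridiag (p + q) u) (skew_tridiag (p + q) v)).
Proof.
move=> pq eC eD.
have sP (i : 'I_(p + q)) : ((if odd i then p + i./2 else i./2) < p + q)%N.
  by case: i => i /= lt_i; case: ifP; lia.
(* Even positions go to the first half, odd ones to the second; [q <= p <= q.+1] makes the
   alternation exhaust both. *)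
pose s i := Ordinal (sP i).
have s_inj : injective s.
  move=> i j [] e; apply/val_inj => /=; move: e (ltn_ord i) (ltn_ord j).
  by case: ifP; case: ifP; lia.
have sE i : (exists2 a : 'I_p, s i = lshift q a & i = a.*2 :> nat) \/
            (exists2 b : 'I_q, s i = rshift p b & i = b.*2.+1 :> nat).
  have [odd_i | even_i] := boolP (odd i); [right | left].
    have lt_i : (i./2 < q)%N by have := ltn_ord i; lia.
    exists (Ordinal lt_i); last by rewrite /=; lia.
    by apply/val_inj; rewrite /= odd_i.
  have lt_i : (i./2 < p)%N by have := ltn_ord i; lia.
  exists (Ordinal lt_i); last by rewrite /=; lia.
  by apply/val_inj; rewrite /= (negbTE even_i).
have main (X : 'M[F]_(p, q)) w :
  (forall a b, X a b = if a == b :> nat then w a.*2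
                       else if a == b.+1 :> nat then - w b.*2.+1 else 0) ->
  perm_mx (perm s_inj) *m bipartite_mx X *m (perm_mx (perm s_inj))^T
    = skew_tridiag (p + q) w.
  move=> eX; rewrite tr_perm_mx -col_permE -row_permE.
  apply/matrixP => i j; rewrite [RHS]mxE [LHS]mxE [LHS]mxE !permE /bipartite_mx.
  have [[a sa ei] | [a sa ei]] := sE i; have [[b sb ej] | [b sb ej]] := sE j;
    rewrite sa sb ei ej.
  - rewrite block_mxEul mxE; do 2 (case: ifP; first by lia); by [].
  - by rewrite block_mxEur eX; do 4 (case: ifP => // ?; try lia).
  - rewrite block_mxEdl !mxE eX.
    by do 4 (case: ifP => // ?; rewrite ?opprK ?oppr0 //; try lia).
  - rewrite block_mxEdr mxE; do 2 (case: ifP; first by lia); by [].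
apply/congruentP; exists (perm_mx (perm s_inj)), (perm_mx (perm s_inj))^T.
rewrite tr_perm_mx -!perm_mxM mulgV mulVg perm_mx1 /= -tr_perm_mx.
by rewrite (main C u) ?(main D v).
Qed.

(** Exchanging the two halves of the rows, with one sign, makes both matrices block diagonal. *)
Lemma equivalent_bipartite p q (C D : 'M[F]_(p, q)) :
  equivalent (SqPair (bipartite_mx C) (bipartite_mx D))
    (mxpair_dsum (MxPair C^T D^T) (MxPair C D)).
Proof.
apply/equivalentP => /=.
exists (block_mx 0 (- 1%:M) 1%:M 0), (block_mx 0 1%:M (- 1%:M) 0), 1%:M, 1%:M.
rewrite !mulmx1 !mulmx_block /= !(mul0mx, mulmx0, mulmx1, mul1mx, add0r, addr0).
by rewrite !(mulNmx, mulmxN, mul1mx, opprK) -!scalar_mx_block.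
Qed.

End Interleaving.

(** * Splitting off a summand *)

Section Splitting.
Variable F : fieldType.

Lemma tr_skew_form m n p (A : 'M[F]_n) (U : 'M[F]_(m, n)) (V : 'M[F]_(p, n)) :
  A^T = - A -> (U *m A *m V^T)^T = - (V *m A *m U^T).
Proof. by move=> skA; rewrite !trmx_mul trmxK skA mulNmx mulmxN mulmxA. Qed.

(** The left kernel of [L] is the complement: invertibility of [E *m L] makes it complementary to
    the rows of [E], and skew symmetry turns the one-sided orthogonality into a two-sided one. *)
Lemma congruent_split n p (A B : 'M[F]_n) (E : 'M[F]_(p, n)) (L : 'M[F]_(n, p)) :
  A^T = - A -> B^T = - B -> E *m L \in unitmx ->
  (forall y : 'rV_n, y *m L = 0 -> y *m A *m E^T = 0 /\ y *m B *m E^T = 0) ->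
  exists q (A' B' : 'M[F]_q),
    [/\ n = (p + q)%N, A'^T = - A', B'^T = - B' &
     congruent (SqPair A B)
       (sqpair_dsum (SqPair (E *m A *m E^T) (E *m B *m E^T)) (SqPair A' B'))].
Proof.
move=> skA skB uEL orth.
have rL : \rank L = p.
  apply/eqP; rewrite eqn_leq rank_leq_col /=.
  by rewrite -[X in (X <= _)%N](mxrank_unit uEL) mxrankM_maxr.
pose W := row_base (kermx L); set q := \rank (kermx L) in W.
have WL : W *m L = 0 by apply/sub_kermxP; rewrite eq_row_base.
have /row_freeP [V0 WV] : row_free W by apply: row_base_free.
clearbody W; have le_pn : (p <= n)%N by rewrite -rL rank_leq_row.
have npq : n = (p + q)%N by rewrite /q mxrank_ker rL; lia.
have orthW (X : 'M[F]_n) : (forall y : 'rV_n, y *m L = 0 -> y *m X *m E^T = 0) ->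
    W *m X *m E^T = 0.
  move=> oX; apply/row_matrixP => i; rewrite !row_mul row0 oX //.
  by rewrite -row_mul WL row0.
have WA : W *m A *m E^T = 0 by apply: orthW => y /orth [].
have WB : W *m B *m E^T = 0 by apply: orthW => y /orth [].
have free : row_free (col_mx E W).
  rewrite -kermx_eq0; apply/eqP/row_matrixP => i; rewrite row0.
  have /sub_kermxP : (row i (kermx (col_mx E W)) <= kermx (col_mx E W))%MS.
    exact: row_sub.
  rewrite -[row i _]hsubmxK mul_row_col; move: (lsubmx _) (rsubmx _) => x y e.
  have x0 : x = 0.
    have /(congr1 (mulmx^~ L)) := e; rewrite mulmxDl -!mulmxA WL mulmx0 addr0 mul0mx.
    by move/(congr1 (mulmx^~ (invmx (E *m L)))); rewrite mulmxK // mul0mx.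
  move: e; rewrite x0 mul0mx add0r => e.
  by rewrite -[y]mulmx1 -WV mulmxA e mul0mx row_mx0.
exists q, (W *m A *m W^T), (W *m B *m W^T).
split; rewrite ?tr_skew_form //.
have [V SV] := row_freeP free.
have VS : V *m col_mx E W = 1%:M.
  move: V (col_mx E W) SV; rewrite -npq => V G; exact: mulmx1C.
apply/congruentP => /=; exists (col_mx E W), V; split=> //.
  rewrite tr_col_mx mul_col_mx mul_col_row WA -[E *m A *m W^T]trmxK.
  by rewrite tr_skew_form // WA oppr0 trmx0.
rewrite tr_col_mx mul_col_mx mul_col_row WB -[E *m B *m W^T]trmxK.
by rewrite tr_skew_form // WB oppr0 trmx0.
Qed.

End Splitting.

(** * Existence *)

Section SelfAdjoint.
Variables (F : fieldType) (n : nat).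
Implicit Types A B M f : 'M[F]_n.

Lemma selfadjointX A f k : f *m A = A *m f^T -> f ^+ k *m A = A *m (f ^+ k)^T.
Proof.
move=> fA; elim: k => [|k IH]; first by rewrite expr0 trmx1 mul1mx mulmx1.
by rewrite exprS -mulmxE -mulmxA IH mulmxA fA -mulmxA -trmx_mul mulmxE -exprSr exprS.
Qed.

(** Doubling the exponent either keeps the rank or lowers it, and [r] bounds the number of drops. *)
Lemma mxrank_pow_stable f :
  exists2 m, (0 < m)%N & \rank (f ^+ m *m f ^+ m) = \rank (f ^+ m).
Proof.
suff H r m : (0 < m)%N -> (\rank (f ^+ m) <= r)%N ->
    exists2 m, (0 < m)%N & \rank (f ^+ m *m f ^+ m) = \rank (f ^+ m).
  exact: (H _ 1 isT (leqnn _)).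
elim: r m => [|r IH] m m_gt0 le_r; have le2 := mxrankM_maxl (f ^+ m) (f ^+ m).
  by exists m; first by []; apply/eqP; rewrite eqn_leq le2 (leq_trans le_r).
have [e|ne] := eqVneq (\rank (f ^+ m *m f ^+ m)) (\rank (f ^+ m)); first by exists m.
apply: (IH (m + m)%N); first by lia.
by rewrite exprD -mulmxE; move: ne le2 le_r; lia.
Qed.

(* Fitting's lemma: the image and the kernel of a high power of [f] are
   orthogonal for every form for which [f] is self-adjoint. *)
Lemma fitting_split A B f :
  A^T = - A -> B^T = - B -> f *m A = A *m f^T -> f *m B = B *m f^T ->
  f \notin unitmx ->
  (exists k, f ^+ k = 0) \/
  exists p q (A1 B1 : 'M[F]_p) (A2 B2 : 'M[F]_q),
    [/\ (p < n)%N, (q < n)%N, A1^T = - A1 /\ B1^T = - B1, A2^T = - A2 /\ B2^T = - B2 &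
     congruent (SqPair A B) (sqpair_dsum (SqPair A1 B1) (SqPair A2 B2))].
Proof.
move=> skA skB fA fB nuf; have [m m_gt0] := mxrank_pow_stable f.
have gA := selfadjointX m fA; have gB := selfadjointX m fB.
have nug : f ^+ m \notin unitmx.
  case: m m_gt0 {gA gB} => // m _; apply: contra nuf.
  by rewrite exprS -mulmxE unitmx_mul => /andP[].
have [g0 | nzg] := eqVneq (f ^+ m) 0; first by left; exists m.
move: (f ^+ m) => g in gA gB nug nzg * => rk2; right.
(* In this full-rank factorization the rows of [E] span the image of [g], and the left kernel of [L]
   is that of [g]. *)
have [p [E [L [V [gLE VL rk_g]]]]] : exists p (E : 'M[F]_(p, n)) (L : 'M[F]_(n, p)) V,
    [/\ g = L *m E, V *m L = 1%:M & \rank g = p].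
  have /row_fullP [V VL] : row_full (col_base g) by apply: col_base_full.
  by exists _, (row_base g), (col_base g), V; rewrite mulmx_base VL.
(* Equal ranks of [g] and [g *m g] mean that image and kernel of [g] meet only in 0. *)
have uEL : E *m L \in unitmx.
  rewrite -row_full_unit /row_full eqn_leq rank_leq_col /=.
  have gg : g *m g = L *m (E *m L *m E) by rewrite gLE !mulmxA.
  by rewrite -{1}rk_g -rk2 gg (leq_trans (mxrankM_maxr _ _)) // mxrankM_maxl.
(* On the kernel [y X g^T = y g X = 0] by self-adjointness; the left inverse [V] of [L] then strips
   [L^T] from [g^T = E^T L^T]. *)
have orth X (y : 'rV_n) : g *m X = X *m g^T -> y *m L = 0 -> y *m X *m E^T = 0.
  move=> gX yL.
  have: y *m X *m E^T *m L^T = 0.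
    by rewrite -mulmxA -trmx_mul -gLE -mulmxA -gX gLE !mulmxA yL !mul0mx.
  by move/(congr1 (mulmx^~ V^T)); rewrite -mulmxA -trmx_mul VL trmx1 mulmx1 mul0mx.
have [y yL|q [A2 [B2 [npq skA2 skB2 cong]]]] := congruent_split skA skB uEL.
  by split; apply: orth.
have p_gt0 : (0 < p)%N by rewrite -rk_g lt0n mxrank_eq0.
have p_ltn : (p < n)%N.
  by rewrite -rk_g ltn_neqAle rank_leq_row andbT; apply: contra nug; rewrite -row_full_unit.
exists p, q, (E *m A *m E^T), (E *m B *m E^T), A2, B2.
by split=> //; [lia | split; rewrite !tr_skew_form].
Qed.

End SelfAdjoint.

(** * The nilpotent block *)

Section NilpotentBlock.
Variable F : fieldType.
Hypothesis two_neq0 : 2%:R != 0 :> F.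

(** A skew form is alternating because 2 is invertible; applied to the forms [f ^+ i *m M], this
    makes every chain of iterates isotropic. *)
Lemma skew_form_diag n (A : 'M[F]_n) (x : 'rV_n) : A^T = - A -> x *m A *m x^T = 0.
Proof.
move=> skA; have := tr_skew_form x x skA.
set X := x *m A *m x^T => /matrixP e; apply/matrixP => i j; rewrite !ord1.
have /eqP := e 0 0; rewrite !mxE eq_sym -subr_eq0 -opprD oppr_eq0 -mulr2n -mulr_natl.
by rewrite mulf_eq0 (negbTE two_neq0) => /eqP.
Qed.

Lemma form_entry m n p (A : 'M[F]_n) (U : 'M[F]_(m, n)) (V : 'M[F]_(p, n)) a b :
  (U *m A *m V^T) a b = (row a U *m A *m (row b V)^T) 0 0.
Proof. by rewrite -row_mul !mxE; apply: eq_bigr => j _; rewrite !mxE. Qed.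

(** The sign of [- (f *m M)] puts [-1] below the diagonal of the off-diagonal block, the pattern
    that interleaving turns into [SkewI k 0]. *)
Lemma nilpotent_split n (M f : 'M[F]_n) k0 :
  (0 < n)%N -> M^T = - M -> M \in unitmx -> f *m M = M *m f^T -> f ^+ k0 = 0 ->
  exists k q (A B : 'M[F]_q),
    [/\ (0 < k)%N, n = (2 * k + q)%N, A^T = - A /\ B^T = - B &
     congruent (SqPair M (- (f *m M)))
       (sqpair_dsum (skew_pair (SkewI k 0)) (SqPair A B))].
Proof.
move=> n_gt0 skM uM fM fk0.
have ex_k : exists k, f ^+ k == 0 by exists k0; rewrite fk0.
case: (ex_minnP ex_k) => k /eqP fk min_k.
have k_gt0 : (0 < k)%N.
  case: k fk {min_k} => // /matrixP /(_ (Ordinal n_gt0) (Ordinal n_gt0)).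
  by move/eqP; rewrite expr0 !mxE eqxx oner_eq0.
have nz_f : f ^+ k.-1 != 0 by apply/negP => /min_k; lia.
have fge j : (k <= j)%N -> f ^+ j = 0 by move=> /subnKC <-; rewrite exprD fk mul0r.
have [u nzu] : exists u : 'rV_n, u *m f ^+ k.-1 != 0.
  have [i nzi] : exists i, row i (f ^+ k.-1) != 0.
    apply/existsP; move: nz_f; apply: contraNT => /existsPn nz.
    by apply/eqP/row_matrixP => i; rewrite row0; apply/eqP; rewrite -[_ == _]negbK nz.
  by exists (delta_mx 0 i); rewrite -rowE.
have skfM i : (f ^+ i *m M)^T = - (f ^+ i *m M).
  by rewrite trmx_mul skM mulNmx -selfadjointX.
(* Self-adjointness gathers all powers on one side, so a pairing of iterates depends only on the
   total exponent. *)
have fE i j (x y : 'rV_n) :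
    (x *m f ^+ i) *m M *m (y *m f ^+ j)^T = x *m (f ^+ (i + j) *m M) *m y^T.
  by rewrite trmx_mul !mulmxA -(mulmxA (_ *m M)) -!mulmxA (mulmxA M) -selfadjointX //
             exprD -mulmxE !mulmxA.
pose iter_rows (w : 'rV_n) : 'M_(k, n) := \matrix_(b < k) (w *m f ^+ b).
(* Listed backwards, so that above the diagonal the total exponent [k.-1 - a + b] is at least [k]:
   the Gram matrix with iterates of any [w] is lower triangular and Toeplitz. *)
pose U : 'M_(k, n) := \matrix_(a < k) (u *m f ^+ (k.-1 - a)).
have pairUW w (a b : 'I_k) : (U *m M *m (iter_rows w)^T) a b =
    if (b <= a)%N then (u *m (f ^+ (k.-1 - (a - b)) *m M) *m w^T) 0 0 else 0.
  rewrite form_entry !rowK fE; have := ltn_ord a; case: ifP => le_ba lt_ak.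
    by congr ((_ *m (f ^+ _ *m _) *m _) _ _); lia.
  by rewrite fge ?mul0mx ?mulmx0 ?mul0mx ?mxE //; lia.
have [w0 pair0] : exists w0 : 'rV_n, (u *m (f ^+ k.-1 *m M) *m w0^T) 0 0 = 1.
  have nz : u *m f ^+ k.-1 *m M != 0.
    apply: contra nzu => /eqP e; rewrite -[_ *m _](mulmxK uM) e mul0mx //.
  have /rV0Pn [i nzi] := nz.
  exists (((u *m f ^+ k.-1 *m M) 0 i)^-1 *: delta_mx 0 i).
  rewrite linearZ /= -scalemxAr mulmxA trmx_delta -colE.
  by rewrite mxE [X in _ * X]mxE mulVf.
have uG : U *m M *m (iter_rows w0)^T \in unitmx.
  rewrite unitmxE det_trig ?unitfE; last first.
    by apply/is_trig_mxP => a b; rewrite pairUW; case: ltnP.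
  rewrite big1 ?oner_eq0 // => a _.
  by rewrite pairUW leqnn subnn subn0.
(* The combination of iterates of [w0] with [U M w^T = e_0]; by the Toeplitz property this one
   column makes all iterates of [w] dual to [U]. *)
pose w := row (Ordinal k_gt0) ((iter_rows w0)^T *m invmx (U *m M *m (iter_rows w0)^T))^T.
have Uw (c : 'I_k) : (U *m M *m w^T) c 0 = (c == 0 :> nat)%:R.
  by rewrite /w tr_row trmxK colE !mulmxA mulmxV // mul1mx !mxE -val_eqE andbT.
pose W := iter_rows w.
have UW : U *m M *m W^T = 1%:M.
  apply/matrixP => a b; rewrite pairUW [RHS]mxE; have lt_ak := ltn_ord a; case: leqP => ab.
    have lt_abk : (a - b < k)%N by lia.
    have := Uw (Ordinal lt_abk); rewrite form_entry rowK row_id /= (mulmxA u) => ->.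
    congr _%:R.
    by rewrite -val_eqE /=; case: eqP; case: eqP; lia.
  by rewrite -val_eqE /= ltn_eqF.
have UU : U *m M *m U^T = 0.
  by apply/matrixP => a b; rewrite form_entry !rowK fE skew_form_diag // !mxE.
have WW : W *m M *m W^T = 0.
  by apply/matrixP => a b; rewrite form_entry !rowK fE skew_form_diag // !mxE.
have WU : W *m M *m U^T = - 1%:M.
  by rewrite -[W *m M *m U^T]trmxK tr_skew_form // UW raddfN /= trmx1.
(* In these bases [f] acts as the lower shift on [U] and as its transpose on [W]. *)
pose S := \matrix_(a < k, b < k) (a == b.+1 :> nat)%:R : 'M[F]_k.
have Uf : U *m f = S *m U.
  apply/row_matrixP => a; rewrite !row_mul rowK -mulmxA mulmxE -exprSr.
  have [a0|a_gt0] := posnP a.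
    rewrite fge ?mulmx0; last by have := ltn_ord a; lia.
    suff -> : row a S = 0 by rewrite mul0mx.
    by apply/rowP => b; rewrite !mxE a0.
  have lt_ak : (a.-1 < k)%N by have := ltn_ord a; lia.
  suff -> : row a S = delta_mx 0 (Ordinal lt_ak).
    by rewrite -rowE rowK /=; congr (_ *m f ^+ _); have := ltn_ord a; lia.
  apply/rowP => b; rewrite !mxE -val_eqE /=.
  by have -> : (a == b.+1 :> nat) = (b == a.-1 :> nat) by lia.
have Wf : W *m f = S^T *m W.
  apply/row_matrixP => a; rewrite !row_mul rowK -mulmxA mulmxE -exprSr.
  have [lt_ak|le_ka] := ltnP a.+1 k.
    suff -> : row a S^T = delta_mx 0 (Ordinal lt_ak) by rewrite -rowE rowK.
    by apply/rowP => b; rewrite !mxE -val_eqE /=.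
  rewrite fge ?mulmx0 //; suff -> : row a S^T = 0 by rewrite mul0mx.
  by apply/rowP => b; rewrite !mxE ltn_eqF // (leq_trans (ltn_ord b)).
pose E := col_mx U W.
have EME : E *m M *m E^T = bipartite_mx 1%:M.
  by rewrite tr_col_mx mul_col_mx mul_col_row UU UW WU WW /bipartite_mx trmx1.
have Ef : E *m f = block_mx S 0 0 S^T *m E.
  by rewrite mul_col_mx mul_block_col !mul0mx addr0 add0r Uf Wf.
have EfME : E *m - (f *m M) *m E^T = bipartite_mx (- S).
  rewrite mulmxN mulNmx !mulmxA Ef -!mulmxA (mulmxA E) EME /bipartite_mx.
  rewrite mulmx_block !(mulmx0, mul0mx, mulmx1, addr0, add0r) opp_block_mx trmx1.
  by rewrite mulmxN mulmx1 oppr0 [(- S)^T]raddfN.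
(* [M] is nondegenerate on the block, so its orthogonal space serves as complement; orthogonality
   for [f *m M] follows because the block is stable under [f]. *)
have [||y yL|q [A [B [npq skA skB cong]]]] :=
    @congruent_split _ n _ M (- (f *m M)) E (M *m E^T) skM.
- by have := skfM 1%N; rewrite expr1 raddfN /= => ->.
- rewrite mulmxA EME.
  suff /mulmx1_unit [] : bipartite_mx 1%:M *m - bipartite_mx 1%:M = 1%:M :> 'M[F]_(k + k).
    by [].
  rewrite mulmxN mulmx_block !(mulmx0, mul0mx, mulmx1, mul1mx, addr0, add0r) trmx1.
  by rewrite opp_block_mx oppr0 opprK -scalar_mx_block.
- split; first by rewrite -mulmxA.
  by rewrite mulmxN mulNmx fM -!mulmxA -trmx_mul Ef trmx_mul !mulmxA -(mulmxA y) yL mul0mx oppr0.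
exists k, q, A, B; split=> //; first by lia.
apply: congruent_trans cong _; apply: congruent_dsum (congruent_refl _).
rewrite EME EfME /= mul2n -addnn; apply: congruent_interleave; first by lia.
  by move=> a b; rewrite !mxE /= !odd_double /= oppr0 if_same -val_eqE; case: eqP.
move=> a b; rewrite !mxE /= !odd_double /=.
have [->|_] := eqVneq (nat_of_ord a) b; first by rewrite ltn_eqF ?oppr0.
by case: eqP; rewrite ?oppr0.
Qed.

End NilpotentBlock.

(** * Kronecker blocks acting on sequences of rows *)

Section KroneckerRows.
Variables (F : fieldType) (k n : nat).
Implicit Types r : nat -> 'rV[F]_n.

Lemma mul_kron_F r :
  kron_F F k *m (\matrix_(i < k.+1) r i) = \matrix_(i < k) r i.
Proof.
apply/row_matrixP => i; rewrite row_mul rowK.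
suff -> : row i (kron_F F k) = delta_mx 0 (widen_ord (leqnSn k) i).
  by rewrite -rowE rowK.
by apply/rowP => j; rewrite !mxE -val_eqE.
Qed.

Lemma mul_kron_G r :
  kron_G F k *m (\matrix_(i < k.+1) r i) = \matrix_(i < k) r i.+1.
Proof.
apply/row_matrixP => i; rewrite row_mul rowK.
suff -> : row i (kron_G F k) = delta_mx 0 (lift ord0 i) by rewrite -rowE rowK.
by apply/rowP => j; rewrite !mxE -val_eqE.
Qed.

Lemma mul_tr_kron_F r : r k = 0 ->
  (kron_F F k)^T *m (\matrix_(i < k) r i) = \matrix_(i < k.+1) r i.
Proof.
move=> rk; apply/row_matrixP => i; rewrite row_mul rowK.
have [lt_ik|le_ki] := ltnP i k.
  suff -> : row i (kron_F F k)^T = delta_mx 0 (Ordinal lt_ik) by rewrite -rowE rowK.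
  by apply/rowP => j; rewrite !mxE -val_eqE eq_sym.
have -> : r i = 0 by have -> : i = k :> nat by have := ltn_ord i; lia.
suff -> : row i (kron_F F k)^T = 0 by rewrite mul0mx.
by apply/rowP => j; rewrite !mxE gtn_eqF // (leq_trans (ltn_ord j)).
Qed.

Lemma mul_tr_kron_G r : r 0%N = 0 ->
  (kron_G F k)^T *m (\matrix_(i < k) r i.+1) = \matrix_(i < k.+1) r i.
Proof.
move=> r0; apply/row_matrixP => i; rewrite row_mul rowK.
case: (unliftP ord0 i) => [j ->|->].
  suff -> : row (lift ord0 j) (kron_G F k)^T = delta_mx 0 j by rewrite -rowE rowK.
  by apply/rowP => l; rewrite !mxE /= eqSS -val_eqE eq_sym.
suff -> : row ord0 (kron_G F k)^T = 0 by rewrite mul0mx r0.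
by apply/rowP => j; rewrite !mxE.
Qed.

End KroneckerRows.

Lemma mul_rows_mx (F : fieldType) k n p (r : 'I_k -> 'rV[F]_n) (X : 'M[F]_(n, p)) :
  (\matrix_(i < k) r i) *m X = \matrix_(i < k) (r i *m X).
Proof. by apply/row_matrixP => i; rewrite row_mul !rowK. Qed.

(** * The singular block *)

Section SingularBlock.
Variable F : fieldType.

(** Fredholm alternative: the column space of [M] is its own double annihilator. *)
Lemma kermx_orthogonal m n (M : 'M[F]_(m, n)) (c : 'cV_m) :
  kermx M *m c = 0 -> exists y, c = M *m y.
Proof.
move=> Kc; suff /submxP [D e] : (c^T <= M^T)%MS.
  by exists D^T; rewrite -[LHS]trmxK e trmx_mul trmxK.
rewrite submxE; have /submxP [Z e] : ((cokermx M^T)^T <= kermx M)%MS.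
  by rewrite sub_kermx -[X in _ *m X]trmxK -trmx_mul mulmx_coker trmx0.
by rewrite -[cokermx _]trmxK e -trmx_mul -mulmxA Kc mulmx0 trmx0.
Qed.

(* The rows of [D] span the first terms of the solutions [w] of a system of
   [k] equations, and a vector orthogonal to [D] comes from the dual system. *)
Lemma chain_alternative n (A B : 'M[F]_n) k :
  exists m (D : 'M[F]_(m, n)),
    (forall x : 'rV_m, exists2 w : nat -> 'rV_n, w 0%N = x *m D &
       forall j, (j < k)%N -> w j *m B = w j.+1 *m A) /\
    (forall c : 'cV_n, D *m c = 0 -> exists y : nat -> 'cV_n,
       [/\ c = B *m y 0%N, forall j, A *m y j = B *m y j.+1
         & forall j, (k <= j)%N -> y j = 0]).
Proof.
elim: k => [|k [m [D [chainD dualD]]]].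
  exists n, 1%:M; split=> [x | c]; first by exists (fun=> x); rewrite ?mulmx1.
  rewrite mul1mx => ->; exists (fun=> 0); split=> *; rewrite ?mulmx0 //.
(* A row [(x, z)] in the left kernel of [N] satisfies [x B = z D A]: it prepends [x] to a chain that
   starts with [z D]. *)
pose N := col_mx B (- (D *m A)).
exists _, (lsubmx (kermx N)); split=> [x | c Dc].
  have [w w0 wE] := chainD (x *m rsubmx (kermx N)).
  exists (fun j => if j is j'.+1 then w j' else x *m lsubmx (kermx N)) => //.
  case=> [_|j]; last exact: wE.
  have := mulmx_ker N; rewrite -{1}[kermx N]hsubmxK mul_row_col => /(congr1 (mulmx x)).
  rewrite mulmxDr mulmx0 w0 mulmxN mulmxN => /eqP; rewrite subr_eq0 => /eqP.
  by rewrite !mulmxA.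
(* The witness has [c = B y0] and [D A y0 = 0], so the induction hypothesis applies to [A y0]. *)
have [|y0] := @kermx_orthogonal _ _ N (col_mx c 0).
  by rewrite -[kermx N]hsubmxK mul_row_col Dc mulmx0 addr0.
rewrite mul_col_mx => /eq_col_mx [cE].
rewrite mulNmx => /esym/eqP; rewrite oppr_eq0 -mulmxA => /eqP /dualD [y [y0E yE y_ge]].
exists (fun j => if j is j'.+1 then y j' else y0); split=> // [[|j]|[|j]] //.
exact: y_ge.
Qed.

(* The polynomial vector of coefficients [u i] is annihilated by the pencil. *)
Definition null_chain n (A B : 'M[F]_n) d (u : nat -> 'rV[F]_n) : Prop :=
  [/\ u 0%N != 0, u 0%N *m B = 0, forall i, u i *m A = u i.+1 *m B
    & forall i, (d <= i)%N -> u i = 0].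

(** Induction on the bound [d]: either the dual system provides a shorter null chain, or it provides
    a chain [w] normalized against [u 0], and the two recurrences then force all pairings of [w]
    with [u]. *)
Lemma null_chain_dual n (A B : 'M[F]_n) d u :
  A^T = - A -> B^T = - B -> null_chain A B d u ->
  exists k (U R : 'M[F]_(k.+1, n)) (W P : 'M[F]_(k, n)),
    [/\ U *m A = (kron_F F k)^T *m P /\ U *m B = (kron_G F k)^T *m P,
        W *m A = kron_F F k *m R /\ W *m B = kron_G F k *m R
      & U *m R^T = 1%:M].
Proof.
move=> skA skB; elim: d u => [|k IH] u [nzu u0B uE u_ge].
  by rewrite u_ge ?eqxx in nzu.
case: k IH u_ge => [|k] IH u_ge.
  (* With [d = 1], [u 0] is killed by both forms: the zero summand of size 1. *)
  have /rV0Pn [i nzi] := nzu.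
  exists 0%N, (u 0%N), ((u 0%N 0 i)^-1 *: delta_mx 0 i), 0, 0.
  rewrite uE u_ge // !mul0mx u0B !mulmx0 !flatmx0; split; try by split.
  apply/matrixP => a b; rewrite !ord1 linearZ /= -scalemxAr trmx_delta -colE.
  by rewrite mxE [X in _ * X]mxE mulVf // mxE.
have [m [D [chainD dualD]]] := chain_alternative A B k.
(* If this vanishes, [A u_0^T = B y_0] for a terminating dual chain, and [u_0, y_0^T, y_1^T, ...] is
   a null chain with a smaller bound. *)
have [Dc|nzDc] := eqVneq (D *m (A *m (u 0%N)^T)) 0.
  have [y [y0 yE y_ge]] := dualD _ Dc.
  have trE X (x : 'cV[F]_n) : X^T = - X -> x^T *m X = - (X *m x)^T.
    by move=> skX; rewrite trmx_mul skX mulmxN opprK.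
  apply: (IH (fun j => if j is j'.+1 then (y j')^T else u 0%N)); split=> //.
    case=> [|j]; last by rewrite !trE // yE.
    by rewrite trE // -y0 trmx_mul trmxK skA mulmxN opprK.
  by case=> // j le_kj; rewrite y_ge ?trmx0.
have [x nzx] : exists x : 'rV_m, x *m D *m A *m (u 0%N)^T != 0.
  have [i nzi] : exists i, row i (D *m (A *m (u 0%N)^T)) != 0.
    apply/existsP; move: nzDc; apply: contraNT => /existsPn nz.
    by apply/eqP/row_matrixP => i; rewrite row0; apply/eqP; rewrite -[_ == _]negbK nz.
  by exists (delta_mx 0 i); rewrite -!mulmxA -rowE.
pose s := (x *m D *m A *m (u 0%N)^T) 0 0.
have nzs : s != 0.
  by apply: contra nzx => /eqP s0; apply/eqP/matrixP => i j; rewrite !ord1 [LHS]s0 mxE.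
have [w w0 wE] := chainD (s^-1 *: x).
have w0u0 : w 0%N *m A *m (u 0%N)^T = 1%:M.
  apply/matrixP => i j; rewrite !ord1 w0 -!scalemxAl mxE -/s mulVf // mxE //.
have swap X i j : X^T = - X -> w j *m X *m (u i)^T = - (u i *m X *m (w j)^T)^T.
  by move=> skX; rewrite tr_skew_form // opprK.
have wBu j i : w j *m B *m (u i.+1)^T = w j *m A *m (u i)^T.
  by rewrite swap // -uE -swap.
have wAu j i : (j < k)%N -> w j.+1 *m A *m (u i.+1)^T = w j *m A *m (u i)^T.
  by move=> lt_jk; rewrite -wE // wBu.
have wBu0 j : w j *m B *m (u 0%N)^T = 0 by rewrite swap // u0B mul0mx trmx0 oppr0.
have shift t j i : (j + t <= k)%N ->
    w (j + t)%N *m A *m (u (i + t)%N)^T = w j *m A *m (u i)^T.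
  elim: t => [|t IHt] le_jtk; first by rewrite !addn0.
  by rewrite !addnS wAu ?IHt //; lia.
(* For [i < j] the pairing slides down to [u 0], which [B] kills; for [i > j] it slides up until [u]
   has ended; on the diagonal it slides to the normalized value. *)
have pair j i : (j <= k)%N -> w j *m A *m (u i)^T = (i == j)%:R%:M.
  move=> le_jk; case: ltngtP => [lt_ij|lt_ji|->].
  - have := shift i (j - i)%N 0%N; rewrite add0n subnK; last exact: ltnW.
    move=> -> //.
    by rewrite -[(j - i)%N]prednK ?subn_gt0 // -wE ?wBu0 ?raddf0 //; lia.
  - have := shift (k - j)%N j i; rewrite subnKC // => <- //.
    by rewrite swap // uE u_ge ?mul0mx ?trmx0 ?oppr0 ?raddf0 //; lia.
  - by have := shift j 0%N 0%N; rewrite !add0n w0u0 => -> //.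
(* The last value continues the recurrence: it is what [w k.+1 *m A] would be. *)
pose r j := if (j <= k)%N then w j *m A else w k *m B.
exists k.+1, (\matrix_(i < k.+2) u i), (\matrix_(i < k.+2) r i).
exists (\matrix_(i < k.+1) w i), (\matrix_(i < k.+1) (u i *m A)).
split.
- split; rewrite mul_rows_mx.
    by rewrite (@mul_tr_kron_F _ _ _ (fun i => u i *m A)) // uE u_ge ?mul0mx.
  rewrite -(@mul_tr_kron_G _ _ _ (fun i => u i *m B)) //; congr (_ *m _).
  by apply/row_matrixP => i; rewrite !rowK uE.
- rewrite mul_kron_F mul_kron_G !mul_rows_mx; split; apply/row_matrixP => i; rewrite !rowK /r.
    by rewrite -ltnS ltn_ord.
  by case: ltnP => [|le_ki]; [exact: wE | have -> : i = k :> nat by have := ltn_ord i; lia].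
apply/matrixP => i j.
have -> : ((\matrix_(i < k.+2) u i) *m (\matrix_(i < k.+2) r i)^T) i j = (r j *m (u i)^T) 0 0.
  by rewrite !mxE; apply: eq_bigr => l _; rewrite !mxE mulrC.
rewrite /r [RHS]mxE -val_eqE /=; case: leqP => [le_jk|lt_kj]; first by rewrite pair // mxE.
have -> : j = k.+1 :> nat by have := ltn_ord j; lia.
case: (nat_of_ord i) => [|i']; first by rewrite wBu0 mxE.
by rewrite wBu pair // mxE eqSS.
Qed.
Lemma mul_kron_FFT k : kron_F F k *m (kron_F F k)^T = 1%:M.
Proof.
apply/matrixP => i j; rewrite !mxE (bigD1 (widen_ord (leqnSn k) i)) //= big1 => [|l].
  by rewrite !mxE /= eqxx mul1r addr0.
by rewrite -val_eqE /= => /negbTE ne; rewrite !mxE ne mul0r.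
Qed.

(** The two conditions make [Q] constant along antidiagonals, with zero in column 0 and past the
    last row. Applied to [P *m U^T], this shows that [U] is isotropic for both forms. *)
Lemma kron_skew_eq0 k (Q : 'M[F]_(k, k.+1)) :
  ((kron_F F k)^T *m Q)^T = - ((kron_F F k)^T *m Q) ->
  ((kron_G F k)^T *m Q)^T = - ((kron_G F k)^T *m Q) -> Q = 0.
Proof.
pose q j := if insub j is Some j' then row j' Q else 0.
have Qq : Q = \matrix_(j < k) q j by apply/row_matrixP => j; rewrite rowK /q valK.
have qk : q k = 0 by rewrite /q insubN // ltnn.
pose q' j := if j is j'.+1 then q j' else 0.
have -> : (kron_F F k)^T *m Q = \matrix_(j < k.+1) q j by rewrite {1}Qq mul_tr_kron_F.
have -> : (kron_G F k)^T *m Q = \matrix_(j < k.+1) q' j.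
  by rewrite {1}Qq -(@mul_tr_kron_G _ _ _ q').
move=> skF skG.
have eF (i j : 'I_k.+1) : q i 0 j = - q j 0 i.
  by have /matrixP /(_ j i) := skF; rewrite !mxE.
have eG (i j : 'I_k.+1) : q' i 0 j = - q' j 0 i.
  by have /matrixP /(_ j i) := skG; rewrite !mxE.
have q0 i : forall (lt_i : (i < k.+1)%N) j, (j < k)%N -> q j 0 (Ordinal lt_i) = 0.
  elim: i => [|i IH] lt_i j lt_jk.
    have lt_j1 : (j.+1 < k.+1)%N by [].
    by have := eG (Ordinal lt_j1) (Ordinal lt_i); rewrite /= mxE oppr0.
  have lt_j1 : (j.+1 < k.+1)%N by [].
  have lt_i' : (i < k.+1)%N by apply: ltnW.
  have := eG (Ordinal lt_j1) (Ordinal lt_i); rewrite /= => ->.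
  have := eF (Ordinal lt_i') (Ordinal lt_j1); rewrite /= => ->; rewrite opprK.
  have [/IH ->|le_kj] := ltnP j.+1 k; first by [].
  by have -> : j.+1 = k; [lia | rewrite qk mxE].
apply/matrixP => j i; rewrite {1}Qq !mxE.
by have := q0 i (ltn_ord i) j (ltn_ord j); congr (q j 0 _ = 0); apply/val_inj.
Qed.

Hypothesis two_neq0 : 2%:R != 0 :> F.

Lemma singular_split n (A B : 'M[F]_n) d u :
  A^T = - A -> B^T = - B -> null_chain A B d u ->
  exists k q (A' B' : 'M[F]_q),
    [/\ n = (k.+1 + k + q)%N, A'^T = - A', B'^T = - B' &
     congruent (SqPair A B)
       (sqpair_dsum (SqPair (bipartite_mx (- (kron_F F k)^T)) (bipartite_mx (- (kron_G F k)^T)))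
          (SqPair A' B'))].
Proof.
move=> skA skB /(null_chain_dual skA skB).
case=> k [U [R [W [P [[UA UB] [WA WB] UR]]]]].
have RU : R *m U^T = 1%:M by rewrite -[LHS]trmxK trmx_mul trmxK UR trmx1.
have PU : P *m U^T = 0.
  apply: kron_skew_eq0; rewrite mulmxA.
    by rewrite -UA tr_skew_form.
  by rewrite -UB tr_skew_form.
have WAU : W *m A *m U^T = kron_F F k by rewrite WA -mulmxA RU mulmx1.
have WBU : W *m B *m U^T = kron_G F k by rewrite WB -mulmxA RU mulmx1.
have UAW : U *m A *m W^T = - (kron_F F k)^T.
  by rewrite -[LHS]trmxK tr_skew_form // WAU raddfN.
have UBW : U *m B *m W^T = - (kron_G F k)^T.
  by rewrite -[LHS]trmxK tr_skew_form // WBU raddfN.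
have PW : P *m W^T = - 1%:M.
  have := congr1 (mulmx (kron_F F k)) UAW.
  by rewrite UA mulmxN !mulmxA mul_kron_FFT mul1mx.
(* Both Gram matrices of [W] have the shape [K (W R^T)^T] with the same [W R^T], so one multiple of
   [U] corrects both; each of the two cross terms removes one half. *)
pose V := W - 2%:R^-1 *: (W *m R^T *m U).
have VE X (Y : 'M_(n, k)) : V *m X *m Y = W *m X *m Y - 2%:R^-1 *: (W *m R^T *m (U *m X *m Y)).
  by rewrite !mulmxBl -!scalemxAl !mulmxA.
have VU X (Y : 'M_(n, k.+1)) : U *m X *m Y = 0 -> V *m X *m Y = W *m X *m Y.
  by move=> e; rewrite !mulmxBl -!scalemxAl -!mulmxA (mulmxA U) e !mulmx0 scaler0 subr0.
have isoV X (K : 'M[F]_(k, k.+1)) : X^T = - X -> W *m X = K *m R ->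
    U *m X *m U^T = 0 -> V *m X *m V^T = 0 /\ V *m X *m U^T = K.
  move=> skX WX UXU.
  have WXU : W *m X *m U^T = K by rewrite WX -mulmxA RU mulmx1.
  have UXW : U *m X *m W^T = - K^T by rewrite -[LHS]trmxK tr_skew_form // WXU raddfN.
  have VXU : V *m X *m U^T = K by rewrite VU.
  split=> //; have VT : V^T = W^T - 2%:R^-1 *: (U^T *m (W *m R^T)^T).
    by rewrite [LHS]raddfB /= linearZ /= trmx_mul.
  rewrite VT mulmxBr -scalemxAr (mulmxA _ U^T) VXU VE UXW.
  have WXW : W *m X *m W^T = K *m (W *m R^T)^T by rewrite trmx_mul trmxK WX mulmxA.
  have e : W *m R^T *m K^T = - (W *m X *m W^T).
    by rewrite -(tr_skew_form W W skX) WXW trmx_mul trmxK.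
  rewrite mulmxN e opprK -WXW -addrA -opprD -scalerDl -mulr2n -[_ *+ 2]mulr_natl.
  by rewrite mulfV // scale1r subrr.
have [VAV VAU] : V *m A *m V^T = 0 /\ V *m A *m U^T = kron_F F k.
  by apply: isoV; rewrite // UA -mulmxA PU mulmx0.
have [VBV VBU] : V *m B *m V^T = 0 /\ V *m B *m U^T = kron_G F k.
  by apply: isoV; rewrite // UB -mulmxA PU mulmx0.
have UPT : U *m P^T = 0 by rewrite -[LHS]trmxK trmx_mul trmxK PU trmx0.
have VP : V *m P^T = - 1%:M.
  rewrite mulmxBl -scalemxAl -(mulmxA _ U) UPT mulmx0 scaler0 subr0.
  by rewrite -[LHS]trmxK trmx_mul trmxK PW raddfN /= trmx1.
have formE X (K : 'M[F]_(k, k.+1)) : X^T = - X -> U *m X *m U^T = 0 ->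
    V *m X *m V^T = 0 -> V *m X *m U^T = K ->
    col_mx U V *m X *m (col_mx U V)^T = bipartite_mx (- K^T).
  move=> skX UXU VXV VXU; rewrite tr_col_mx mul_col_mx mul_col_row UXU VXV VXU.
  by rewrite -[U *m X *m _]trmxK tr_skew_form // VXU /bipartite_mx raddfN /= raddfN /= trmxK opprK.
have UAU : U *m A *m U^T = 0 by rewrite UA -mulmxA PU mulmx0.
have UBU : U *m B *m U^T = 0 by rewrite UB -mulmxA PU mulmx0.
have orth X (K K' : 'M[F]_(k, k.+1)) (y : 'rV_n) : X^T = - X -> U *m X = K'^T *m P ->
    W *m X = K *m R -> y *m row_mx R^T P^T = 0 -> y *m X *m (col_mx U V)^T = 0.
  move=> skX UX WX; rewrite mul_mx_row -row_mx0 => /eq_row_mx [yR yP].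
  have yE m (Y : 'M[F]_(m, n)) : y *m X *m Y^T = - (y *m (Y *m X)^T).
    by rewrite trmx_mul skX mulNmx mulmxN opprK mulmxA.
  rewrite yE mul_col_mx mulmxBl -scalemxAl -(mulmxA _ U) UX WX.
  rewrite tr_col_mx [(_ - _)^T]raddfB /= linearZ /= !trmx_mul mul_mx_row mulmxBr.
  by rewrite -scalemxAr !mulmxA yR yP !mul0mx scaler0 subr0 row_mx0 oppr0.
(* Block triangular, with diagonal blocks [U R^T = 1] and [V P^T = -1]. *)
have uEL : col_mx U V *m row_mx R^T P^T \in unitmx.
  rewrite mul_col_row UR UPT VP unitmxE det_lblock det1 mul1r.
  by rewrite -raddfN /= det_scalar unitrX // unitrN1.
have [y yL|q [A' [B' [nE skA' skB' cong]]]] := congruent_split skA skB uEL.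
  by split; [apply: orth UA WA yL | apply: orth UB WB yL].
exists k, q, A', B'; split=> //.
by rewrite (formE A (kron_F F k)) ?(formE B (kron_G F k)) in cong.
Qed.

End SingularBlock.

(** * Recombining the two members of a pair *)

Section LinearCombinations.
Variable F : fieldType.
Implicit Types (a b c d : F) (P Q : sqpair F).

(** These recombinations turn the single block [SkewI k 0] into type (i) with any eigenvalue and
    into type (ii) of even size. *)
Definition sqpair_lincomb a b c d P : sqpair F :=
  SqPair (a *: sqfst P + b *: sqsnd P) (c *: sqfst P + d *: sqsnd P).

Lemma congruent_lincomb a b c d P Q :
  congruent P Q -> congruent (sqpair_lincomb a b c d P) (sqpair_lincomb a b c d Q).
Proof.
move=> /congruentP [E [E' [EE' E'E eA eB]]]; apply/congruentP => /=.
exists E, E'; split=> //.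
  by rewrite mulmxDr mulmxDl -!scalemxAr -!scalemxAl eA eB.
by rewrite mulmxDr mulmxDl -!scalemxAr -!scalemxAl eA eB.
Qed.

Lemma sqpair_lincomb_dsum a b c d P Q :
  sqpair_lincomb a b c d (sqpair_dsum P Q) =
  sqpair_dsum (sqpair_lincomb a b c d P) (sqpair_lincomb a b c d Q).
Proof.
by rewrite /sqpair_lincomb /= !scale_block_mx !add_block_mx !scaler0 !addr0.
Qed.

Lemma lincomb_SkewI k lambda :
  sqpair_lincomb 1 0 lambda 1 (skew_pair (SkewI k 0)) = skew_pair (SkewI k lambda).
Proof.
congr SqPair; apply/matrixP => i j; rewrite !mxE.
  by case: (nat_of_ord j == _); [|case: (nat_of_ord i == _)];
    [case: (odd _); ring | case: (odd _); ring | ring].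
by case: (nat_of_ord j == _); [|case: (nat_of_ord i == _)];
  [case: (odd _); ring | case: (odd _); ring | ring].
Qed.

Lemma lincomb_SkewII k :
  sqpair_lincomb 0 1 1 0 (skew_pair (SkewI k 0)) = skew_pair (SkewII F (2 * k)).
Proof.
congr SqPair; apply/matrixP => i j; rewrite !mxE.
  by case: (nat_of_ord j == _); [|case: (nat_of_ord i == _)];
    [case: (odd _); ring | case: (odd _); ring | ring].
by case: (nat_of_ord j == _); [|case: (nat_of_ord i == _)];
  [case: (odd _); ring | case: (odd _); ring | ring].
Qed.

Lemma bipartite_SkewII k :
  congruent (SqPair (bipartite_mx (- (kron_G F k)^T)) (bipartite_mx (kron_F F k)^T))
    (skew_pair (SkewII F (2 * k + 1))).
Proof.
rewrite /=; have -> : (2 * k + 1 = k.+1 + k)%N by lia.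
apply: congruent_interleave; first by lia.
  move=> a b; rewrite !mxE /= !odd_double /=; have [->|_] := eqVneq (a : nat) b.
    by rewrite ltn_eqF ?oppr0.
  by case: eqP; rewrite ?oppr0.
by move=> a b; rewrite !mxE /= !odd_double /= oppr0 if_same; case: eqP.
Qed.

End LinearCombinations.

Lemma quotient_selfadjoint (F : fieldType) n (M X : 'M[F]_n) :
  M^T = - M -> X^T = - X -> M \in unitmx ->
  let f := X *m invmx M in
  [/\ f *m M = X, f *m M = M *m f^T & f *m X = X *m f^T].
Proof.
move=> skM skX uM f; have fM : f *m M = X by rewrite mulmxKV.
have fMT : f *m M = M *m f^T.
  by rewrite fM; apply: oppr_inj; rewrite -skX -fM trmx_mul skM mulNmx.
by split=> //; rewrite -fM -mulmxA -fMT.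
Qed.

Lemma singular_null_chain (F : fieldType) n (A B : 'M[F]_n) :
  \det (map_mx polyC A + 'X *: map_mx polyC B) = 0 ->
  exists d u, null_chain (- B) A d u.
Proof.
move=> /eqP /det0P [v nzv vM].
pose c i := \row_j (v 0 j)`_i.
have cE i : c i *m A + (if i is i'.+1 then c i' *m B else 0) = 0.
  apply/rowP => j; have /rowP /(_ j) /(congr1 (coefp i)) := vM.
  rewrite !mxE /= coef_sum coef0 => e; rewrite -[RHS]e.
  case: i {e} => [|i]; rewrite !mxE ?addr0 -?big_split; apply: eq_bigr => l _ /=;
    by rewrite !mxE mulrDr coefD coefMC mulrA coefMC coefMX ?mul0r ?addr0.
have [i0 nzc] : exists i, c i != 0.
  have /rV0Pn [j nzj] := nzv; exists (size (v 0 j)).-1.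
  by apply: contra nzj => /eqP /rowP /(_ j) /eqP; rewrite !mxE lead_coef_eq0.
(* Dividing [v] by the largest possible power of ['X] gives the nonzero constant coefficient that
   [null_chain] requires. *)
case: (ex_minnP (ex_intro (fun i => c i != 0) _ nzc)) => m nzm min_m.
exists (\max_j size (v 0%R j))%N, (fun i => c (m + i)%N); split.
- by rewrite addn0.
- rewrite addn0; have := cE m; case: m nzm min_m => [|m] _ min_m; first by rewrite addr0.
  have -> : c m = 0 by apply/eqP/negPn/negP => /min_m; rewrite ltnn.
  by rewrite mul0mx addr0.
- move=> i; rewrite addnS mulmxN; apply/eqP; rewrite eq_sym -subr_eq0 opprK.
  by rewrite cE.
move=> i le_di; apply/rowP => j; rewrite !mxE nth_default //.
by apply: leq_trans (leq_addl _ _); apply: leq_trans le_di; apply: leq_bigmax.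
Qed.

(** * Induction on the size *)

Section Existence.
Variable F : closedFieldType.
Hypothesis two_neq0 : 2%:R != 0 :> F.

Let canonizable n (A B : 'M[F]_n) : Prop :=
  exists s : seq (skew_index F), skew_form (SqPair A B) s.

Lemma canonizable_cons n (A B : 'M[F]_n) b q (A' B' : 'M[F]_q) :
  skew_index_valid b ->
  congruent (SqPair A B) (sqpair_dsum (skew_pair b) (SqPair A' B')) ->
  canonizable A' B' -> canonizable A B.
Proof.
move=> b_ok cong [s [s_ok cong']]; exists (b :: s); split; first by rewrite /= b_ok.
exact: congruent_trans cong (congruent_dsum (congruent_refl _) cong').
Qed.

Lemma eigenvalue_exists n (T : 'M[F]_n) : (0 < n)%N -> exists a, eigenvalue T a.
Proof.
move=> n_gt0; have /closed_rootP [a ra] : size (char_poly T) != 1%N.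
  by rewrite size_char_poly eqSS -lt0n.
by exists a; rewrite eigenvalue_root_char.
Qed.

Lemma skew_form_exists n (A B : 'M[F]_n) :
  A^T = - A -> B^T = - B -> canonizable A B.
Proof.
elim/ltn_ind: n A B => n IH A B skA skB.
have [n0|n_gt0] := posnP n.
  subst n; exists [::]; split=> //; rewrite /= (flatmx0 A) (flatmx0 B).
  exact: congruent_refl.
have fitting f : f *m A = A *m f^T -> f *m B = B *m f^T -> f \notin unitmx ->
    (exists k, f ^+ k = 0) \/ canonizable A B.
  move=> fA fB nuf; have [[k fk]|] := fitting_split skA skB fA fB nuf.
    by left; exists k.
  case=> p [q [A1 [B1 [A2 [B2 [lt_pn lt_qn [skA1 skB1] [skA2 skB2] cong]]]]]]; right.
  have [s1 [ok1 cong1]] := IH p lt_pn A1 B1 skA1 skB1.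
  have [s2 [ok2 cong2]] := IH q lt_qn A2 B2 skA2 skB2.
  exists (s1 ++ s2); split; first by rewrite all_cat ok1.
  by rewrite map_cat sqpair_dsums_cat; apply: congruent_trans cong (congruent_dsum _ _).
have skewZ (a b : F) q (X Y : 'M[F]_q) : X^T = - X -> Y^T = - Y ->
    (a *: X + b *: Y)^T = - (a *: X + b *: Y).
  by move=> skX skY; rewrite linearD !linearZ /= skX skY !scalerN -opprD.
have [det0|/closed_nonrootP [mu nz]] :=
    eqVneq (\det (map_mx polyC A + 'X *: map_mx polyC B)) 0.
  have [d [u chain]] := singular_null_chain det0.
  have skNB : (- B)^T = - - B by rewrite raddfN /= skB.
  have [k [q [A' [B' [nE skA' skB' cong]]]]] := singular_split two_neq0 skNB skA chain.
  (* The chain belongs to [(- B, A)]; these coefficients bring that pair back to [(A, B)]. *)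
  have := congruent_lincomb 0 1 (-1) 0 cong.
  rewrite sqpair_lincomb_dsum /sqpair_lincomb /=.
  rewrite !scale0r !scale1r !scaleN1r !addr0 !add0r opprK => cong'.
  apply: (@canonizable_cons _ _ _ (SkewII F (2 * k + 1)) _ B' (- A')).
  - by rewrite /= addn1.
  - apply: congruent_trans cong' (congruent_dsum _ (congruent_refl _)).
    have -> : - bipartite_mx (- (kron_F F k)^T) = bipartite_mx (kron_F F k)^T.
      by rewrite opp_block_mx !oppr0 opprK [(- _)^T]raddfN /= opprK.
    exact: bipartite_SkewII.
  - by apply: IH; rewrite ?skB' //; [lia | rewrite raddfN /= skA'].
have uM : A + mu *: B \in unitmx.
  rewrite unitmxE unitfE; move: nz; rewrite /root -horner_evalE -det_map_mx.
  congr (\det _ != 0); apply/matrixP => i j.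
  by rewrite !mxE /= /horner_eval !hornerE.
have core M f k0 (a b c d : F) b0 :
   M^T = - M -> M \in unitmx -> f *m M = M *m f^T -> f ^+ k0 = 0 ->
   A = a *: M + b *: (- (f *m M)) -> B = c *: M + d *: (- (f *m M)) ->
   (forall k, (0 < k)%N -> skew_index_valid (b0 k) /\
      sqpair_lincomb a b c d (skew_pair (SkewI k 0)) = skew_pair (b0 k)) ->
   canonizable A B.
  move=> skM uM' fM fk0 eA eB b0E.
  have [k [q [A' [B' [k_gt0 nE [skA' skB'] cong]]]]] :=
    nilpotent_split two_neq0 n_gt0 skM uM' fM fk0.
  have [ok bE] := b0E k k_gt0.
  have := congruent_lincomb a b c d cong.
  rewrite sqpair_lincomb_dsum bE {1}/sqpair_lincomb /= -eA -eB => cong'.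
  apply: canonizable_cons ok cong' _.
  by apply: IH => /=; [lia | apply: skewZ | apply: skewZ].
have [uA|nuA] := boolP (A \in unitmx).
  (* The eigenvalue [a] makes [f = a - B A^-1] singular, so Fitting's lemma applies; the block found
     then has eigenvalue [a]. *)
  have [a /eigenvalueP [v va nzv]] := eigenvalue_exists (B *m invmx A) n_gt0.
  have skX : (a *: A - B)^T = - (a *: A - B) by rewrite -scaleN1r skewZ.
  have := quotient_selfadjoint skA skX uA.
  set f := _ *m invmx A => -[fAX fA fX].
  have nuf : f \notin unitmx.
    apply: contra nzv => uf; rewrite -[v](mulmxK uf).
    rewrite /f mulmxBl -scalemxAl mulmxV // mulmxBr va -scalemxAr mulmx1 subrr.
    by rewrite mul0mx.
  have eB : B = a *: A - f *m A by rewrite fAX opprB addrC subrK.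
  have fB : f *m B = B *m f^T.
    by rewrite eB mulmxBr mulmxBl -scalemxAl -scalemxAr fA !mulmxA fA.
  have [[k fk]|//] := fitting f fA fB nuf.
  apply: (core A f k 1 0 a 1 (fun k => SkewI k a)) => //.
  - by rewrite scale1r scale0r addr0.
  - by rewrite scale1r.
  - by move=> j j_gt0; rewrite lincomb_SkewI.
(* [A] is singular here. Unless the pair splits, nilpotency of the quotient of [A] by [A + mu B]
   shows that [B] is invertible, and the block is then built from the quotient of [- A] by [B]: the
   infinite eigenvalue. *)
have nz_mu : mu != 0 by apply: contra nuA => /eqP mu0; rewrite mu0 scale0r addr0 in uM.
have skM : (A + mu *: B)^T = - (A + mu *: B) by rewrite -{1 2}[A]scale1r skewZ.
have := quotient_selfadjoint skM skA uM; set M := A + mu *: B in uM skM *.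
set f := A *m invmx M => -[fM fMT fA].
have nuf : f \notin unitmx by apply: contra nuA => uf; rewrite -fM unitmx_mul uf.
have eB : B = mu^-1 *: (M - A) by rewrite /M addrC addKr scalerA mulVf ?scale1r.
have fB : f *m B = B *m f^T by rewrite eB -scalemxAr -scalemxAl mulmxBr mulmxBl fMT fA.
have [[k fk]|//] := fitting f fA fB nuf.
have uB : B \in unitmx.
  (* The geometric series inverts [1 - f], and [mu B = (1 - f) M]. *)
  have u1f : 1%:M - f \in unitmx.
    have [] // := @mulmx1_unit _ _ (1%:M - f) (\sum_(i < k) f ^+ i) _.
    have := subrX1 f k; rewrite fk sub0r mulmxE => /(congr1 -%R).
    by rewrite opprK -mulNr opprB => <-.
  by rewrite eB unitmxZ ?unitfE ?invr_eq0 // -fM -{1}[M]mul1mx -mulmxBl unitmx_mul u1f.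
have skNA : (- A)^T = - - A by rewrite raddfN /= skA.
have := quotient_selfadjoint skB skNA uB.
set N := _ *m invmx B => -[NB NBT NA].
have nuN : N \notin unitmx.
  apply: contra nuA => uN; have : N *m B \in unitmx by rewrite unitmx_mul uN.
  by rewrite NB -scaleN1r unitmxZ ?unitrN1.
have [|[j Nj]|//] := fitting N _ NBT nuN.
  by apply: oppr_inj; rewrite -mulmxN NA mulNmx.
apply: (core B N j 0 1 1 0 (fun k => SkewII F (2 * k))) => //.
- by rewrite scale1r scale0r add0r NB opprK.
- by rewrite scale1r scale0r addr0.
- by move=> i i_gt0; rewrite lincomb_SkewII /=; split=> //; lia.
Qed.

End Existence.

(** * Kronecker canonical forms of the summands *)

Section KroneckerFormsOfBlocks.
Variable F : fieldType.

(** Monomial matrices, that is permutations and scalings, suffice to bring every off-diagonal block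
    to its Kronecker form. *)
Lemma equivalent_rescale p q (A B A' B' : 'M[F]_(p, q))
    (f : 'I_p -> 'I_p) (g : 'I_q -> 'I_q) (r : 'I_p -> F) (s : 'I_q -> F) :
  injective f -> injective g -> (forall i, r i != 0) -> (forall j, s j != 0) ->
  (forall i j, A' i j = r i * s j * A (f i) (g j)) ->
  (forall i j, B' i j = r i * s j * B (f i) (g j)) ->
  equivalent (MxPair A B) (MxPair A' B').
Proof.
move=> f_inj g_inj nzr nzs eA eB.
have diag_unit n (d : 'I_n -> F) : (forall i, d i != 0) ->
    diag_mx (\row_i d i) \in unitmx.
  move=> nzd; rewrite unitmxE det_diag unitfE; apply/prodf_neq0 => i _.
  by rewrite mxE nzd.
exists (diag_mx (\row_i r i) *m perm_mx (perm f_inj)).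
exists ((perm_mx (perm g_inj))^T *m diag_mx (\row_j s j)).
rewrite !unitmx_mul unitmx_tr !unitmx_perm !diag_unit //; split=> //=.
have main X : diag_mx (\row_i r i) *m perm_mx (perm f_inj) *m X *m
     ((perm_mx (perm g_inj))^T *m diag_mx (\row_j s j)) =
     \matrix_(i, j) (r i * s j * X (f i) (g j)).
  rewrite mulmxA mul_mx_diag -!mulmxA mul_diag_mx tr_perm_mx -col_permE -row_permE.
  by apply/matrixP => i j; rewrite !mxE !permE mulrAC.
by congr MxPair; apply/matrixP => i j; rewrite main !mxE ?eA ?eB.
Qed.

Lemma equivalent_dsum_nil (K : mxpair F) :
  equivalent K (mxpair_dsum K (mxpair_dsums [::])).
Proof.
case: K => p q A B; apply/equivalentP => /=.
exists (col_mx 1%:M 0), (row_mx 1%:M 0), (row_mx 1%:M 0), (col_mx 1%:M 0).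
have e0 : 0 = 1%:M :> 'M[F]_0 by apply/matrixP => - [].
rewrite !mul_col_row !mul_row_col (mul_col_mx _ _ A) (mul_col_mx _ _ B) !mul_col_row.
rewrite !(mul0mx, mulmx0, mul1mx, mulmx1, addr0).
have e1 n : block_mx (1%:M : 'M[F]_n) 0 0 0 = 1%:M :> 'M_(n + 0).
  by rewrite [X in block_mx _ _ _ X]e0 -scalar_mx_block.
by rewrite !e1.
Qed.

Lemma kronecker_form2 (P : sqpair F) (b c : kron_index F) (K L : mxpair F) :
  kron_index_valid b -> kron_index_valid c ->
  equivalent P (mxpair_dsum K L) ->
  equivalent K (kron_pair b) -> equivalent L (kron_pair c) ->
  kronecker_form P [:: b; c].
Proof.
move=> ok_b ok_c eqP eqK eqL; split; first by rewrite /= ok_b ok_c.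
apply: equivalent_trans eqP (equivalent_dsum eqK _).
exact: equivalent_trans eqL (equivalent_dsum_nil _).
Qed.

Lemma signr_nz n : (-1) ^+ n != 0 :> F.
Proof. by rewrite signr_eq0. Qed.

(** The off-diagonal block that remains once the isotropic halves of a tridiagonal summand are
    separated; its minus signs come from skew symmetry. *)
Definition subdiag_mx k (lambda : F) : 'M[F]_k :=
  \matrix_(a, b) (if a == b :> nat then lambda else - (a == b.+1 :> nat)%:R).

Lemma sign_same n : (-1) ^+ n * (-1) ^+ n = 1 :> F.
Proof. by rewrite -expr2 sqrr_sign. Qed.

Lemma subdiag_rescale k (lambda : F) (i j : 'I_k) :
  jordan_block k lambda i j =
  (-1) ^+ i * (-1) ^+ j * subdiag_mx k lambda (rev_ord i) (rev_ord j).
Proof.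
rewrite !mxE /= -val_eqE /=; have [e|ne] := eqVneq (i : nat) j.
  by rewrite e eqxx sign_same mul1r.
have -> : (k - i.+1 == k - j.+1)%N = false.
  by have := ltn_ord i; have := ltn_ord j; move: ne; lia.
have -> : (k - i.+1 == (k - j.+1).+1)%N = (j == i.+1 :> nat).
  by have := ltn_ord i; have := ltn_ord j; lia.
by case: eqP => [->|_]; rewrite ?oppr0 ?mulr0 // exprS mulN1r !(mulrN, mulNr) opprK sign_same mulr1.
Qed.

Lemma tr_subdiag_rescale k (lambda : F) (i j : 'I_k) :
  jordan_block k lambda i j =
  (-1) ^+ i * (-1) ^+ j * (subdiag_mx k lambda)^T i j.
Proof.
rewrite !mxE /= -val_eqE /= eq_sym; have [e|ne] := eqVneq (j : nat) i.
  by rewrite e sign_same mul1r.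
by case: eqP => [->|_]; rewrite ?oppr0 ?mulr0 // exprS mulN1r !(mulrN, mulNr) opprK sign_same mulr1.
Qed.

Lemma id_rescale k (f : 'I_k -> 'I_k) (i j : 'I_k) : injective f ->
  1%:M i j = (-1) ^+ i * (-1) ^+ j * (1%:M : 'M[F]_k) (f i) (f j).
Proof.
move=> f_inj; rewrite !mxE (inj_eq f_inj); case: eqP => [->|_]; last by rewrite mulr0.
by rewrite sign_same mulr1.
Qed.

Lemma kronecker_SkewI k (lambda : F) : (0 < k)%N ->
  kronecker_form (skew_pair (SkewI k lambda)) [:: KronIJ k lambda; KronIJ k lambda].
Proof.
move=> k_gt0; have cong : congruent (skew_pair (SkewI k lambda))
    (SqPair (bipartite_mx 1%:M) (bipartite_mx (subdiag_mx k lambda))).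
  apply: congruent_sym; rewrite /= mul2n -addnn; apply: congruent_interleave; first by lia.
    by move=> a b; rewrite !mxE /= !odd_double /= oppr0 if_same -val_eqE; case: eqP.
  move=> a b; rewrite !mxE /= !odd_double /=.
  by case: ifP => // _; case: eqP; rewrite ?oppr0.
have := equivalent_trans (congruent_equivalent cong) (equivalent_bipartite _ _).
rewrite trmx1 => eqv; apply: kronecker_form2 eqv _ _ => //.
  apply: (@equivalent_rescale _ _ _ _ _ _ id id (fun i => (-1) ^+ i) (fun j => (-1) ^+ j)) => //;
    try by move=> *; exact: signr_nz.
    by move=> i j; apply: (id_rescale (f := id)).
  exact: tr_subdiag_rescale.
apply: (@equivalent_rescale _ _ _ _ _ _ (@rev_ord k) (@rev_ord k)
  (fun i => (-1) ^+ i) (fun j => (-1) ^+ j)) => //;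
  try by [exact: rev_ord_inj | move=> *; exact: signr_nz].
  by move=> i j; apply: id_rescale; exact: rev_ord_inj.
exact: subdiag_rescale.
Qed.

Lemma kronecker_SkewII_even k : (0 < k)%N ->
  kronecker_form (skew_pair (SkewII F (2 * k))) [:: KronJI F k; KronJI F k].
Proof.
move=> k_gt0; have cong : congruent (skew_pair (SkewII F (2 * k)))
    (SqPair (bipartite_mx (subdiag_mx k 0)) (bipartite_mx 1%:M)).
  apply: congruent_sym; rewrite /= mul2n -addnn; apply: congruent_interleave; first by lia.
    move=> a b; rewrite !mxE /= !odd_double /=.
    by case: ifP => // _; case: eqP; rewrite ?oppr0.
  by move=> a b; rewrite !mxE /= !odd_double /= oppr0 if_same -val_eqE; case: eqP.
have := equivalent_trans (congruent_equivalent cong) (equivalent_bipartite _ _).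
rewrite trmx1 => eqv; apply: kronecker_form2 eqv _ _ => //.
  apply: (@equivalent_rescale _ _ _ _ _ _ id id (fun i => (-1) ^+ i) (fun j => (-1) ^+ j)) => //;
    try by move=> *; exact: signr_nz.
    exact: tr_subdiag_rescale.
  by move=> i j; apply: (id_rescale (f := id)).
apply: (@equivalent_rescale _ _ _ _ _ _ (@rev_ord k) (@rev_ord k)
  (fun i => (-1) ^+ i) (fun j => (-1) ^+ j)) => //;
  try by [exact: rev_ord_inj | move=> *; exact: signr_nz].
  exact: subdiag_rescale.
by move=> i j; apply: id_rescale; exact: rev_ord_inj.
Qed.

(** Reversing rows and columns exchanges [kron_F] and [kron_G]; the shifted exponent [i.+1] absorbs
    the minus sign of [- kron_G]. *)
Lemma kron_rescale k (i : 'I_k) (j : 'I_k.+1) :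
  kron_F F k i j = (-1) ^+ i.+1 * (-1) ^+ j * (- kron_G F k (rev_ord i) (rev_ord j)) /\
  kron_G F k i j = (-1) ^+ i.+1 * (-1) ^+ j * kron_F F k (rev_ord i) (rev_ord j).
Proof.
rewrite !mxE /=; have lt_i := ltn_ord i; have lt_j := ltn_ord j; split.
  have -> : (k.+1 - j.+1 == (k - i.+1).+1)%N = (j == i :> nat) by lia.
  case: eqP => [->|_]; last by rewrite oppr0 mulr0.
  by rewrite exprS mulN1r !(mulrN, mulNr) opprK sign_same mulr1.
have -> : (k.+1 - j.+1 == k - i.+1)%N = (j == i.+1 :> nat) by lia.
by case: eqP => [->|_]; rewrite ?mulr0 // sign_same mulr1.
Qed.

Lemma kronecker_SkewII_odd k :
  kronecker_form (skew_pair (SkewII F (2 * k + 1))) [:: KronFG F k; KronFGT F k].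
Proof.
have := equivalent_trans (congruent_equivalent (congruent_sym (bipartite_SkewII F k)))
  (equivalent_bipartite _ _).
have tE (X : 'M[F]_(k, k.+1)) a b : X^T a b = X b a by rewrite mxE.
have nE p q (X : 'M[F]_(p, q)) a b : (- X) a b = - X a b by rewrite mxE.
rewrite trmxK raddfN /= trmxK => eqv; apply: kronecker_form2 eqv _ _ => //.
  apply: (@equivalent_rescale _ _ _ _ _ _ (@rev_ord k) (@rev_ord k.+1)
    (fun i => (-1) ^+ i.+1) (fun j => (-1) ^+ j));
    try by [exact: rev_ord_inj | move=> *; exact: signr_nz].
    by move=> i j; rewrite nE; case: (kron_rescale i j).
  by move=> i j; case: (kron_rescale i j).
apply: (@equivalent_rescale _ _ _ _ _ _ (@rev_ord k.+1) (@rev_ord k)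
    (fun i => (-1) ^+ i) (fun j => (-1) ^+ j.+1));
    try by [exact: rev_ord_inj | move=> *; exact: signr_nz].
  by move=> i j; rewrite nE !tE [X in X * _]mulrC; case: (kron_rescale j i).
by move=> i j; rewrite !tE [X in X * _]mulrC; case: (kron_rescale j i).
Qed.

End KroneckerFormsOfBlocks.

(** * Uniqueness *)

Lemma dim_linear_bij (F : fieldType) (V V' : vectType F) (g : V' -> V)
    (U' : {vspace V'}) (U : {vspace V}) :
  linear g -> injective g -> (forall x, x \in U' -> g x \in U) ->
  (forall y, y \in U -> exists2 x, x \in U' & g x = y) -> \dim U = \dim U'.
Proof.
move=> g_lin g_inj gU' gU.
pose gL : {linear V' -> V} := HB.pack g (GRing.isLinear.Build _ _ _ _ g g_lin).
have gE x : linfun gL x = g x by rewrite lfunE.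
have -> : U = (linfun gL @: U')%VS.
  apply/vspaceP => y; apply/idP/memv_imgP => [/gU [x Ux <-]|[x Ux ->]].
    by exists x; rewrite ?gE.
  by rewrite gE gU'.
apply: limg_dim_eq; apply/eqP; rewrite -subv0; apply/subvP => x.
rewrite memv_cap memv_ker gE memv0 => /andP[_ /eqP gx0].
have g0 : g 0 = 0 := linear0 gL.
by apply/eqP/g_inj; rewrite gx0 g0.
Qed.

(** * Test spaces and their dimensions *)

Section Invariants.
Variable F : fieldType.
Implicit Types K T : mxpair F.

(* Evaluated at a suitable family of test pairs [T], these dimensions are a
   complete invariant of [K] under equivalence. *)
Definition test_map K T (X : 'M[F]_(ncols K, nrows T)) :=
  mxfst K *m X *m mxfst T - mxsnd K *m X *m mxsnd T.

Lemma test_map_linear K T : linear (@test_map K T).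
Proof.
move=> a X Y; rewrite /test_map !mulmxDr !mulmxDl -!scalemxAr -!scalemxAl.
by rewrite scalerBr opprD addrACA.
Qed.

HB.instance Definition _ K T :=
  GRing.isLinear.Build _ _ _ _ (@test_map K T) (@test_map_linear K T).

Definition test_space K T : {vspace 'M[F]_(ncols K, nrows T)} :=
  lker (linfun (@test_map K T)).

Definition hdim K T := \dim (test_space K T).

Lemma test_spaceP K T X :
  reflect (mxfst K *m X *m mxfst T = mxsnd K *m X *m mxsnd T) (X \in test_space K T).
Proof.
rewrite memv_ker lfunE /= subr_eq0; exact: eqP.
Qed.

Lemma hdim_param K T d (g : 'rV[F]_d -> 'M_(ncols K, nrows T)) :
  linear g -> injective g ->
  (forall c, mxfst K *m g c *m mxfst T = mxsnd K *m g c *m mxsnd T) ->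
  (forall X, mxfst K *m X *m mxfst T = mxsnd K *m X *m mxsnd T -> exists c, g c = X) ->
  hdim K T = d.
Proof.
move=> g_lin g_inj gU gV; rewrite /hdim (dim_linear_bij (U' := fullv) g_lin g_inj).
- by rewrite dimvf /dim /= mul1n.
- by move=> c _; apply/test_spaceP.
- by move=> X /test_spaceP /gV [c]; exists c; rewrite ?memvf.
Qed.

Lemma hdim_eq0 K T :
  (forall X, mxfst K *m X *m mxfst T = mxsnd K *m X *m mxsnd T -> X = 0) -> hdim K T = 0%N.
Proof.
move=> all0; apply/eqP; rewrite dimv_eq0 -subv0; apply/subvP => X /test_spaceP /all0 ->.
exact: mem0v.
Qed.

Lemma hdim_equivalent K L T : equivalent K L -> hdim K T = hdim L T.
Proof.
case=> R [S [uR uS <-]]; set L' := MxPair _ _.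
apply: (@dim_linear_bij _ _ _ (fun X => S *m X)) => /=.
- by move=> a X Y; rewrite mulmxDr scalemxAr.
- by apply: (can_inj (g := mulmx (invmx S))) => X; rewrite mulKmx.
- move=> X /(@test_spaceP L' T X) /= e; apply/test_spaceP.
  by apply: (can_inj (mulKmx uR)); rewrite !mulmxA.
- move=> Y /test_spaceP e; exists (invmx S *m Y); last by rewrite mulKVmx.
  apply/(@test_spaceP L' T (invmx S *m Y)) => /=.
  by rewrite -!(mulmxA _ S) !mulKVmx // -!(mulmxA R) e.
Qed.

Lemma hdim_dsum K L T : hdim (mxpair_dsum K L) T = (hdim K T + hdim L T)%N.
Proof.
pose V := (subvs_of (test_space K T) * subvs_of (test_space L T))%type.
pose g (v : V) := col_mx (vsval v.1) (vsval v.2).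
have -> : (hdim K T + hdim L T = \dim (fullv : {vspace V}))%N by rewrite dimvf.
apply: (@dim_linear_bij _ _ _ g).
- by move=> a v w; rewrite /g scale_col_mx add_col_mx -!linearP.
- by move=> [x y] [x' y'] /eq_col_mx /= [/val_inj -> /val_inj ->].
- move=> [x y] _; apply/(@test_spaceP (mxpair_dsum K L) T _); rewrite /g /=.
  rewrite !mul_block_col !mul0mx !addr0 !add0r !mul_col_mx.
  congr col_mx; [apply/(@test_spaceP K T (vsval x)) | apply/(@test_spaceP L T (vsval y))];
    exact: subvsP.
move=> Y /(@test_spaceP (mxpair_dsum K L) T _) /=; rewrite -[Y]vsubmxK.
rewrite !mul_block_col !mul0mx !addr0 !add0r !mul_col_mx.
case/eq_col_mx => /(@test_spaceP K T _) KY /(@test_spaceP L T _) LY.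
exists (vsproj _ (usubmx Y), vsproj _ (dsubmx Y)); first by rewrite memvf.
by rewrite /g /= !vsprojK.
Qed.

Lemma hdim_dsums (s : seq (mxpair F)) T :
  hdim (mxpair_dsums s) T = (\sum_(K <- s) hdim K T)%N.
Proof.
elim: s => [|K s IH]; last by rewrite big_cons hdim_dsum IH.
by rewrite big_nil; apply: hdim_eq0 => X _; rewrite [X]flatmx0.
Qed.

End Invariants.

(** * Matrices as zero-padded sequences of rows *)

Section InvariantsOfBlocks.
Variable F : fieldType.

(** Total on [nat], so that a recurrence can step over the border and read a boundary condition
    there. *)
Definition entry m n (X : 'M[F]_(m, n)) (i j : nat) : F :=
  if (insub i, insub j) is (Some i', Some j') then X i' j' else 0.

Lemma entryE m n (X : 'M[F]_(m, n)) (i : 'I_m) (j : 'I_n) : entry X i j = X i j.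
Proof. by rewrite /entry !valK. Qed.

Lemma entry_out m n (X : 'M[F]_(m, n)) i j : (m <= i)%N || (n <= j)%N -> entry X i j = 0.
Proof.
rewrite /entry; case: insubP => [i' lt_i _|//]; case: insubP => [j' lt_j _|//].
by case/orP; rewrite leqNgt ?lt_i ?lt_j.
Qed.

Lemma entryP m n (X : 'M[F]_(m, n)) a Y i j :
  entry (a *: X + Y) i j = a * entry X i j + entry Y i j.
Proof.
rewrite /entry; case: insub => [i'|]; last by rewrite mulr0 addr0.
by case: insub => [j'|]; rewrite ?mulr0 ?addr0 // !mxE.
Qed.

Definition rows m n (X : 'M[F]_(m, n)) (i : nat) : 'rV[F]_n := \row_j entry X i j.

Lemma rowsE m n (X : 'M[F]_(m, n)) : X = \matrix_(i < m) rows X i.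
Proof. by apply/matrixP => i j; rewrite !mxE entryE. Qed.

Lemma rows_out m n (X : 'M[F]_(m, n)) i : (m <= i)%N -> rows X i = 0.
Proof. by move=> le_mi; apply/rowP => j; rewrite !mxE entry_out ?le_mi. Qed.

Lemma eq_rows m n (r r' : 'I_m -> 'rV[F]_n) :
  \matrix_(i < m) r i = \matrix_(i < m) r' i ->
  forall i (lt_im : (i < m)%N), r (Ordinal lt_im) = r' (Ordinal lt_im).
Proof. by move=> /row_matrixP e i lt_im; have := e (Ordinal lt_im); rewrite !rowK. Qed.

Lemma mul_jordan k n mu (r : nat -> 'rV[F]_n) : r k = 0 ->
  jordan_block k mu *m \matrix_(i < k) r i = \matrix_(i < k) (mu *: r i + r i.+1).
Proof.
move=> rk; apply/row_matrixP => i; rewrite row_mul rowK.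
have -> : row i (jordan_block k mu) = mu *: delta_mx 0 i + row i (jordan_block k 0).
  apply/rowP => j; rewrite !mxE /= [j == i]eq_sym; case: eqP => [_|_].
    by rewrite mulr1 addr0.
  by rewrite mulr0 add0r.
rewrite mulmxDl -scalemxAl -rowE rowK; congr (_ + _).
have [lt_ik|le_ki] := ltnP i.+1 k.
  suff -> : row i (jordan_block k (0 : F)) = delta_mx 0 (Ordinal lt_ik) by rewrite -rowE rowK.
  apply/rowP => j; rewrite !mxE -!val_eqE /=; case: (i =P j :> nat) => // <-.
  by rewrite ltn_eqF.
have -> : i.+1 = k by have := ltn_ord i; lia.
suff -> : row i (jordan_block k (0 : F)) = 0 by rewrite mul0mx rk.
apply/rowP => j; rewrite !mxE -!val_eqE /=; case: eqP => // _.
by rewrite ltn_eqF // (leq_trans (ltn_ord j)).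
Qed.

Lemma row_kron_F m (f : nat -> F) :
  (\row_(j < m) f j) *m kron_F F m = \row_(j < m.+1) (if (j < m)%N then f j else 0).
Proof.
apply/rowP => j; rewrite !mxE; case: ifP => lt_jm.
  rewrite (bigD1 (Ordinal lt_jm)) //= big1 => [|l]; first by rewrite !mxE eqxx mulr1 addr0.
  by rewrite -val_eqE /= eq_sym => /negbTE ne; rewrite !mxE ne mulr0.
by rewrite big1 // => l _; rewrite !mxE gtn_eqF ?mulr0 // (leq_trans (ltn_ord l)) // leqNgt lt_jm.
Qed.

Lemma row_kron_G m (f : nat -> F) :
  (\row_(j < m) f j) *m kron_G F m = \row_(j < m.+1) (if nat_of_ord j is j'.+1 then f j' else 0).
Proof.
apply/rowP => j; rewrite !mxE; case: (unliftP ord0 j) => [j' ->|->] /=.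
  rewrite (bigD1 j') //= big1 => [|l]; first by rewrite !mxE /= eqxx mulr1 addr0.
  by rewrite -val_eqE /= eq_sym => /negbTE ne; rewrite !mxE /= eqSS ne mulr0.
by rewrite big1 // => l _; rewrite !mxE mulr0.
Qed.

Lemma row_jordan m (f : nat -> F) :
  (\row_(j < m) f j) *m jordan_block m 0 =
  \row_(j < m) (if nat_of_ord j is j'.+1 then f j' else 0).
Proof.
apply/rowP => j; have /rowP /(_ (widen_ord (leqnSn m) j)) := row_kron_G m f.
rewrite !mxE /= => <-; apply: eq_bigr => l _; rewrite !mxE -val_eqE /=.
by case: eqP => // ->; rewrite ltn_eqF.
Qed.

(** Descent from row [k]: [Q] is injective on rows, so [r i.+1 = 0] forces [r i = 0]. *)
Lemma rows_down k m l (P Q : 'M[F]_(m, l)) (r : nat -> 'rV[F]_m) :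
  row_free Q -> (forall i, (k <= i)%N -> r i = 0) ->
  (forall i, (i < k)%N -> r i *m Q = r i.+1 *m P) -> forall i, r i = 0.
Proof.
move=> fQ r_out rE; suff H t i : (k <= i + t)%N -> r i = 0 by move=> i; apply: (H k); lia.
elim: t i => [|t IH] i le_k; first by apply: r_out; lia.
have [lt_ik|] := ltnP i k; last exact: r_out.
apply/eqP; rewrite -(mulmx_free_eq0 (r i) fQ) rE // IH ?mul0mx //; lia.
Qed.

Lemma jordan_unit m (mu : F) : mu != 0 -> jordan_block m mu \in unitmx.
Proof.
move=> nz; rewrite -unitmx_tr unitmxE det_trig ?unitfE.
  by apply/prodf_neq0 => i _; rewrite !mxE eqxx.
by apply/is_trig_mxP => i j lt_ij; rewrite !mxE -val_eqE /= gtn_eqF // ltn_eqF // ltnW.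
Qed.

Lemma jordan_blockD m a b : jordan_block m a + b%:M = jordan_block m (a + b) :> 'M[F]_m.
Proof. by apply/matrixP => i j; rewrite !mxE; case: eqP; rewrite ?addr0. Qed.

Lemma unit_1BN m (mu : F) : 1%:M - mu *: jordan_block m 0 \in unitmx.
Proof.
have [->|nz] := eqVneq mu 0; first by rewrite scale0r subr0 unitmx1.
have -> : 1%:M - mu *: jordan_block m 0 = - mu *: jordan_block m (- mu^-1).
  rewrite -[- mu^-1]add0r -jordan_blockD scalerDr addrC scaleNr; congr (_ + _).
  by rewrite scale_scalar_mx mulrNN mulfV.
by rewrite unitmxZ ?unitfE ?oppr_eq0 // jordan_unit // oppr_eq0 invr_eq0.
Qed.

Lemma mul_kron_GFT m : kron_G F m *m (kron_F F m)^T = jordan_block m 0.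
Proof.
have e : (kron_F F m)^T = \matrix_(i < m.+1) \row_(j < m) (i == j :> nat)%:R.
  by apply/matrixP => i j; rewrite !mxE.
rewrite e (@mul_kron_G _ _ _ (fun i => \row_(j < m) (i == j :> nat)%:R)).
apply/matrixP => i j; rewrite !mxE -val_eqE /= eq_sym.
by case: (i =P j :> nat) => // ->; rewrite ltn_eqF.
Qed.

(** Multiplication by the transpose of [kron_F] gives [1 - mu J(0)], which is invertible. *)
Lemma row_free_FBG m mu : row_free (kron_F F m - mu *: kron_G F m).
Proof.
rewrite -kermx_eq0 -submx0; apply/row_subP => i; have := mulmx_ker (kron_F F m - mu *: kron_G F m).
move/(congr1 (fun X => row i X *m (kron_F F m)^T)).
rewrite row_mul -mulmxA mulmxBl -scalemxAl mul_kron_FFT mul_kron_GFT row0 mul0mx.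
by move/(canRL (mulmxK (unit_1BN m mu))) => ->; rewrite mul0mx sub0mx.
Qed.

Lemma row_free_G m : row_free (kron_G F m).
Proof.
apply/row_freeP; exists (kron_G F m)^T.
have e : (kron_G F m)^T = \matrix_(i < m.+1) \row_(j < m) (i == j.+1 :> nat)%:R.
  by apply/matrixP => i j; rewrite !mxE.
rewrite e (@mul_kron_G _ _ _ (fun i => \row_(j < m) (i == j.+1 :> nat)%:R)).
by apply/matrixP => i j; rewrite !mxE eqSS.
Qed.

Lemma row_free1 m : row_free (1%:M : 'M[F]_m).
Proof. by apply/row_freeP; exists 1%:M; rewrite mulmx1. Qed.

End InvariantsOfBlocks.

(** * Test dimensions of each Kronecker block *)

Section DimensionsOfBlocks.
Variable F : fieldType.

(* The solutions of [N X = X N] are the matrices constant along diagonals that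
   vanish outside the last [minn k m] diagonals. *)
Lemma hdim_toeplitz k m (A B : 'M[F]_k) (P Q : 'M[F]_m) :
  (forall X : 'M_(k, m), A *m X *m P = B *m X *m Q <->
     jordan_block k 0 *m X = X *m jordan_block m 0) ->
  hdim (MxPair A B) (MxPair P Q) = minn k m.
Proof.
move=> eqX; set d := minn k m.
(* Diagonals are numbered by their distance from the top right corner; beyond [d] the default value
   of [entry] makes them zero. *)
pose f (c : 'rV[F]_d) i j := entry c 0 (m.-1 - j + i).
pose h c i : 'rV_m := \row_(j < m) f c i j.
pose g c : 'M[F]_(k, m) := \matrix_(i < k) h c i.
apply: (@hdim_param _ (MxPair A B) (MxPair P Q) d g).
- by move=> a c c'; apply/matrixP => i j; rewrite !mxE /f entryP.
- move=> c c' /matrixP e; apply/rowP => s; have := ltn_ord s; rewrite {2}/d => lt_s.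
  have lt0k : (0 < k)%N by lia.
  have lt_m : (m.-1 - s < m)%N by lia.
  have := e (Ordinal lt0k) (Ordinal lt_m); rewrite !mxE /f /=.
  have -> : (m.-1 - (m.-1 - s) + 0 = s)%N by lia.
  by rewrite !(entryE _ (0 : 'I_1)).
- move=> c; apply/eqX; rewrite /g (@mul_jordan _ _ _ _ (h c)).
    rewrite mul_rows_mx; apply/row_matrixP => i; rewrite !rowK row_jordan scale0r add0r.
    apply/rowP => j; rewrite !mxE /f; case: j => - [|j] /= lt_j.
      by rewrite entry_out //; apply/orP; right; lia.
    by congr entry; lia.
  apply/rowP => j; rewrite !mxE /f entry_out //; apply/orP; right.
  by have := ltn_ord j; lia.
move=> /= X /eqX NX; pose x := entry X.
have xE i j : (i < k)%N -> (j.+1 < m)%N -> x i.+1 j.+1 = x i j.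
  move=> lt_i lt_j; have := NX; rewrite {1 2}[X]rowsE mul_jordan ?rows_out //.
  rewrite mul_rows_mx => /eq_rows /(_ i lt_i) /rowP /(_ (Ordinal lt_j)).
  by rewrite scale0r add0r row_jordan !mxE.
have x0 i : (i < k)%N -> x i.+1 0%N = 0.
  move=> lt_i; case: (posnP m) => [m0|m_gt0]; first by apply: entry_out; rewrite m0 orbT.
  have := NX; rewrite {1 2}[X]rowsE mul_jordan ?rows_out //.
  rewrite mul_rows_mx => /eq_rows /(_ i lt_i) /rowP /(_ (Ordinal m_gt0)).
  by rewrite scale0r add0r row_jordan !mxE.
have shift t i j : (i + t <= k)%N -> (j + t < m)%N -> x (i + t)%N (j + t)%N = x i j.
  elim: t => [|t IH] le_i lt_j; first by rewrite !addn0.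
  by rewrite !addnS xE ?IH //; lia.
exists (\row_(s < d) x 0%N (m.-1 - s)%N); apply/matrixP => i j; rewrite !mxE /f.
have lt_i := ltn_ord i; have lt_j := ltn_ord j.
have entry_c s : entry (\row_(s < d) x 0%N (m.-1 - s)%N) 0 s =
    if (s < d)%N then x 0%N (m.-1 - s)%N else 0.
  case: ifP => lt_sd; last by rewrite entry_out // [X in _ || X]leqNgt lt_sd orbT.
  by rewrite (entryE _ (0 : 'I_1) (Ordinal lt_sd)) mxE.
rewrite entry_c -entryE -/x; have [le_ij|lt_ji] := leqP i j.
  have := shift i 0%N (j - i)%N; rewrite add0n subnK // => -> //; last by lia.
  case: ifP => [_|/negbT]; first by congr (x _ _); lia.
  rewrite -leqNgt /d => le_d; have := shift k 0%N (j - i)%N.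
  rewrite add0n => <- //; last by lia.
  by rewrite /x entry_out ?leqnn.
have := shift j (i - j)%N 0%N; rewrite subnK ?add0n => [-> //|]; try lia.
have -> : (i - j = (i - j).-1.+1)%N by lia.
by rewrite x0 ?if_same //; [case: ifP => // lt_d; move: lt_d; rewrite /d; lia | lia].
Qed.

(* Here the solutions are constant along antidiagonals. *)
Lemma hdim_FG_FG k m :
  hdim (kron_pair (KronFG F k)) (kron_pair (KronFG F m)) = (m - k)%N.
Proof.
set d := (m - k)%N.
(* Only the antidiagonals with [k <= i + j < m] survive: smaller sums reach column 0 above the last
   row, larger ones run past the last column. *)
pose f (c : 'rV[F]_d) i j := if (k <= i + j)%N then entry c 0 (i + j - k) else 0.
pose h c i : 'rV_m := \row_(j < m) f c i j.
pose g c : 'M[F]_(k.+1, m) := \matrix_(i < k.+1) h c i.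
apply: (@hdim_param _ (kron_pair (KronFG F k)) (kron_pair (KronFG F m)) d g).
- move=> a c c'; apply/matrixP => i j; rewrite !mxE /f entryP.
  by case: ifP; rewrite ?mulr0 ?addr0.
- move=> c c' /matrixP e; apply/rowP => s; have := ltn_ord s; rewrite {2}/d => lt_s.
  have lt_m : (s < m)%N by lia.
  have := e ord_max (Ordinal lt_m); rewrite !mxE /f /= leq_addr addKn.
  by rewrite !(entryE _ (0 : 'I_1)).
- move=> c; rewrite /= /g (mul_kron_F _ (h c)) (mul_kron_G _ (h c)).
  rewrite !mul_rows_mx.
  apply/row_matrixP => i; rewrite !rowK row_kron_F row_kron_G.
  apply/rowP => j; rewrite !mxE /f; case: j => - [|j] /= lt_j.
    have -> : (k <= i + 0)%N = false by have := ltn_ord i; lia.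
    by rewrite if_same.
  rewrite addSnnS; case: ltnP => [//|le_mj]; case: ifP => // le_k.
  by rewrite entry_out //; apply/orP; right; rewrite /d; lia.
move=> /= X e; pose x := entry X.
have rE i : (i < k)%N -> rows X i *m kron_F F m = rows X i.+1 *m kron_G F m.
  move: e; rewrite {1 2}[X]rowsE mul_kron_F mul_kron_G !mul_rows_mx => /eq_rows e.
  exact: e.
have xE i j : (i < k)%N -> x i j.+1 = x i.+1 j.
  move=> lt_i; have [le_mj|lt_jm] := leqP m j.
    by rewrite /x !entry_out //; apply/orP; right; lia.
  have /rowP /(_ (Ordinal (lt_jm : j.+1 < m.+1)%N)) := rE i lt_i.
  rewrite row_kron_F row_kron_G !mxE /= /x => <-; case: ltnP => // le_mj.
  by rewrite entry_out // le_mj orbT.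
have x0 i : (i < k)%N -> x i 0%N = 0.
  move=> lt_i; have /rowP /(_ ord0) := rE i lt_i.
  rewrite row_kron_F row_kron_G !mxE /=; case: ltnP => // le_m _.
  by rewrite /x entry_out // le_m orbT.
have shift t i j : (i + t <= k)%N -> x i (j + t)%N = x (i + t)%N j.
  elim: t i => [|t IH] i le_i; first by rewrite !addn0.
  by rewrite addnS xE ?IH ?addSnnS //; lia.
exists (\row_(s < d) x k s); apply/matrixP => i j; rewrite !mxE /f -entryE -/x.
have lt_i := ltn_ord i; have lt_j := ltn_ord j.
have [le_k|lt_k] := leqP k (i + j).
  have := shift (k - i)%N i (i + j - k)%N; have -> : (i + j - k + (k - i) = j)%N by lia.
  have -> : (i + (k - i) = k)%N by lia.
  move=> -> //; have [lt_d|le_d] := ltnP (i + j - k) d.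
    by rewrite (entryE _ (0 : 'I_1) (Ordinal lt_d)) mxE.
  rewrite entry_out ?le_d ?orbT //; have := shift k 0%N (i + j - k)%N.
  by rewrite add0n => <- //; rewrite /x entry_out //; apply/orP; right; move: le_d; rewrite /d; lia.
have := shift j i 0%N; rewrite add0n => ->; last by lia.
by rewrite x0.
Qed.

(** The order is opposite to that of [KronIJ], so that the solutions against [(I, J_k(mu))] are the
    intertwiners [X J_m(lambda) = J_k(mu) X]. *)
Definition test_jordan m (lambda : F) : mxpair F := MxPair (jordan_block m lambda) 1%:M.

Lemma hdim_IJ_jordan k mu m lambda :
  hdim (kron_pair (KronIJ k mu)) (test_jordan m lambda) =
  if mu == lambda then minn k m else 0%N.
Proof.
have [->|ne] := eqVneq.
  apply: hdim_toeplitz => X; rewrite mul1mx mulmx1.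
  have e n : jordan_block n lambda = jordan_block n 0 + lambda%:M by rewrite jordan_blockD add0r.
  rewrite !e mulmxDr mulmxDl mul_mx_scalar mul_scalar_mx; split=> [/addIr|] -> //.
apply: hdim_eq0 => /= X; rewrite mul1mx mulmx1 [X]rowsE mul_jordan ?rows_out //.
rewrite mul_rows_mx => /eq_rows e.
have unit_lm : row_free (jordan_block m (lambda - mu)).
  by rewrite row_free_unit jordan_unit // subr_eq0 eq_sym.
apply/row_matrixP => i; rewrite rowK row0.
apply: (rows_down (k := k) (P := 1%:M) unit_lm) => [j|j /e /= ej]; first exact: rows_out.
rewrite -jordan_blockD mulmxDr ej raddfN /= mulmxN mul_mx_scalar mulmx1.
by rewrite addrAC subrr add0r.
Qed.

Lemma hdim_JI_jordan k m lambda :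
  hdim (kron_pair (KronJI F k)) (test_jordan m lambda) = 0%N.
Proof.
apply: hdim_eq0 => /= X; rewrite mul1mx mulmx1 {1}[X]rowsE mul_jordan ?rows_out //.
rewrite mul_rows_mx [RHS]rowsE => /eq_rows e; rewrite [X]rowsE.
apply/row_matrixP => i; rewrite rowK row0.
apply: (rows_down (k := k) (row_free1 F m) (P := jordan_block m lambda)) => [j|j /e /=].
  exact: rows_out.
by rewrite scale0r add0r mulmx1 => ->.
Qed.

(** Row 0 is free and determines the others. The value is linear in [m], hence invisible to second
    differences. *)
Lemma hdim_FG_jordan k m lambda :
  hdim (kron_pair (KronFG F k)) (test_jordan m lambda) = m.
Proof.
pose h (v : 'rV[F]_m) i := v *m jordan_block m lambda ^+ i.
pose g (v : 'rV[F]_m) : 'M[F]_(k.+1, m) := \matrix_(i < k.+1) h v i.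
apply: (@hdim_param _ (kron_pair (KronFG F k)) (test_jordan m lambda) m g).
- move=> a v w; apply/row_matrixP => i.
  by rewrite linearP /= !rowK /h mulmxDl scalemxAl.
- by move=> v w /row_matrixP /(_ ord0); rewrite !rowK /h /= expr0 !mulmx1.
- move=> v; rewrite /= /g mulmx1.
  rewrite (mul_kron_F _ (h v)) (mul_kron_G _ (h v)) mul_rows_mx.
  by apply/row_matrixP => i; rewrite !rowK /h -mulmxA mulmxE -exprSr.
move=> /= X; rewrite mulmx1 [X]rowsE mul_kron_F mul_kron_G mul_rows_mx => /eq_rows e.
exists (rows X 0%N); apply/row_matrixP => i; rewrite !rowK /h.
elim: (nat_of_ord i) (ltn_ord i) => [|j IH] lt_j; first by rewrite expr0 mulmx1.
by have /= <- := e j lt_j; rewrite -IH 1?ltnW // exprSr -mulmxE mulmxA.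
Qed.

Lemma FGT_rows k m l (P Q : 'M[F]_(m, l)) (X : 'M_(k, m)) :
  (kron_F F k)^T *m X *m P = (kron_G F k)^T *m X *m Q ->
  forall i, (i <= k)%N -> rows X i *m P = if i is j.+1 then rows X j *m Q else 0.
Proof.
rewrite {1 2}[X]rowsE mul_tr_kron_F ?rows_out //.
rewrite (@mul_tr_kron_G _ _ _ (fun i => if i is j.+1 then rows X j else 0)) //.
rewrite !mul_rows_mx => /eq_rows e i le_ik; have /= -> := e i le_ik.
by case: i {le_ik}; rewrite ?mul0mx.
Qed.

Lemma hdim_FGT_row_free k m l (P Q : 'M[F]_(m, l)) :
  row_free Q -> hdim (kron_pair (KronFGT F k)) (MxPair P Q) = 0%N.
Proof.
move=> fQ; apply: hdim_eq0 => /= X /FGT_rows e; rewrite [X]rowsE.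
apply/row_matrixP => i; rewrite rowK row0.
apply: (rows_down (k := k) fQ (P := P)) => [j|j lt_j]; first exact: rows_out.
by rewrite (e j.+1).
Qed.

Lemma hdim_FGT_infinity k m :
  hdim (kron_pair (KronFGT F k)) (kron_pair (KronIJ m (0 : F))) = 0%N.
Proof.
apply: hdim_eq0 => /= X /FGT_rows e; rewrite [X]rowsE.
apply/row_matrixP => i; rewrite rowK row0; have := ltn_ord i.
elim: (nat_of_ord i) => [|j IH] lt_j; have := e _ (ltnW lt_j); rewrite mulmx1 // => ->.
by rewrite IH ?mul0mx // ltnW.
Qed.

Lemma hdim_IJ_infinity k mu m :
  hdim (kron_pair (KronIJ k mu)) (kron_pair (KronIJ m (0 : F))) = 0%N.
Proof.
apply: hdim_eq0 => /= X; rewrite mul1mx mulmx1 {2}[X]rowsE mul_jordan ?rows_out //.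
rewrite mul_rows_mx [LHS]rowsE => /eq_rows e; rewrite [X]rowsE.
apply/row_matrixP => i; rewrite rowK row0.
have fQ : row_free (1%:M - mu *: jordan_block m 0) by rewrite row_free_unit unit_1BN.
apply: (rows_down (k := k) fQ (P := jordan_block m 0)) => [j|j /e /= ej].
  exact: rows_out.
by rewrite mulmxBr mulmx1 {1}ej mulmxDl -scalemxAl -scalemxAr addrAC subrr add0r.
Qed.

Lemma hdim_JI_infinity k m :
  hdim (kron_pair (KronJI F k)) (kron_pair (KronIJ m (0 : F))) = minn k m.
Proof. by apply: hdim_toeplitz => X; rewrite mul1mx mulmx1. Qed.

Lemma hdim_FG_infinity k m :
  hdim (kron_pair (KronFG F k)) (kron_pair (KronIJ m (0 : F))) = m.
Proof.
pose h (v : 'rV[F]_m) i := v *m jordan_block m 0 ^+ (k - i).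
pose g (v : 'rV[F]_m) : 'M[F]_(k.+1, m) := \matrix_(i < k.+1) h v i.
apply: (@hdim_param _ (kron_pair (KronFG F k)) (kron_pair (KronIJ m (0 : F))) m g).
- move=> a v w; apply/row_matrixP => i.
  by rewrite linearP /= !rowK /h mulmxDl scalemxAl.
- by move=> v w /row_matrixP /(_ ord_max); rewrite !rowK /h subnn expr0 !mulmx1.
- move=> v; rewrite /= /g mulmx1.
  rewrite (mul_kron_F _ (h v)) (mul_kron_G _ (h v)) mul_rows_mx.
  apply/row_matrixP => i; rewrite !rowK /h -mulmxA mulmxE -exprSr.
  by congr (_ *m _ ^+ _); have := ltn_ord i; lia.
move=> /= X; rewrite mulmx1 [X]rowsE mul_kron_F mul_kron_G mul_rows_mx => /eq_rows e.
exists (rows X k); apply/row_matrixP => i; rewrite !rowK /h.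
have H t : (t <= k)%N -> rows X (k - t) = rows X k *m jordan_block m 0 ^+ t.
  elim: t => [|t IH] le_t; first by rewrite subn0 expr0 mulmx1.
  have lt_k : (k - t.+1 < k)%N by lia.
  have /= -> := e _ lt_k; have -> : (k - t.+1).+1 = (k - t)%N by lia.
  by rewrite IH 1?ltnW // exprSr -mulmxE mulmxA.
by rewrite -H ?leq_subr // subKn // -ltnS.
Qed.

Lemma hdim_IJ_FG k mu m :
  hdim (kron_pair (KronIJ k mu)) (kron_pair (KronFG F m)) = 0%N.
Proof.
apply: hdim_eq0 => /= X; rewrite mul1mx {1 2}[X]rowsE mul_jordan ?rows_out //.
rewrite !mul_rows_mx => /eq_rows e; rewrite [X]rowsE.
apply/row_matrixP => i; rewrite rowK row0.
apply: (rows_down (k := k) (row_free_FBG m mu) (P := kron_G F m)) => [j|j /e /= ej].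
  exact: rows_out.
by rewrite mulmxBr ej mulmxDl -scalemxAl -scalemxAr addrAC subrr add0r.
Qed.

Lemma hdim_JI_FG k m :
  hdim (kron_pair (KronJI F k)) (kron_pair (KronFG F m)) = 0%N.
Proof.
apply: hdim_eq0 => /= X; rewrite mul1mx {1 2}[X]rowsE mul_jordan ?rows_out //.
rewrite !mul_rows_mx => /eq_rows e; rewrite [X]rowsE.
apply/row_matrixP => i; rewrite rowK row0.
apply: (rows_down (k := k) (row_free_G F m) (P := kron_F F m)) => [j|j /e /=].
  exact: rows_out.
by rewrite scale0r add0r => ->.
Qed.

End DimensionsOfBlocks.

(** * Recovering the multiplicities *)

Section Uniqueness.
Variable F : fieldType.
Implicit Types (s : seq (skew_index F)) (T : mxpair F).

Lemma hdim_kronecker_form (P : mxpair F) c T :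
  kronecker_form P c -> hdim P T = (\sum_(b <- c) hdim (kron_pair b) T)%N.
Proof. by case=> _ /hdim_equivalent ->; rewrite hdim_dsums big_map. Qed.

Lemma hdim_skew_form (P : sqpair F) s T :
  skew_form P s -> hdim P T = (\sum_(b <- s) hdim (skew_pair b) T)%N.
Proof.
case=> _ /congruent_equivalent /hdim_equivalent ->.
by rewrite mxpair_of_sqpair_dsums hdim_dsums !big_map.
Qed.

(** A second difference written without subtraction: [f] and [g] are its two sides and [w] is the
    jump caused by one copy of [b0]. *)
Lemma skew_index_count s s' (b0 : skew_index F) (f g : skew_index F -> nat) w :
  (0 < w)%N -> (forall b, skew_index_valid b -> f b + w * (b == b0) = g b)%N ->
  all (@skew_index_valid F) s -> all (@skew_index_valid F) s' ->
  (\sum_(b <- s) f b = \sum_(b <- s') f b)%N ->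
  (\sum_(b <- s) g b = \sum_(b <- s') g b)%N ->
  count_mem b0 s = count_mem b0 s'.
Proof.
move=> w_gt0 fg ok ok' ef eg.
have sumE r : all (@skew_index_valid F) r ->
    (\sum_(b <- r) f b + w * count_mem b0 r = \sum_(b <- r) g b)%N.
  elim: r => [|b r IH] /=; first by rewrite !big_nil muln0.
  case/andP=> ok_b ok_r; rewrite !big_cons -IH // -fg //=; lia.
by apply/eqP; rewrite -(eqn_pmul2l w_gt0) -(eqn_add2l (\sum_(b <- s) f b)) {2}ef !sumE ?eg.
Qed.

Lemma hdim_SkewI_jordan k (mu : F) m lambda : (0 < k)%N ->
  hdim (skew_pair (SkewI k mu)) (test_jordan m lambda) =
  (if mu == lambda then 2 * minn k m else 0)%N.
Proof.
move=> k_gt0; rewrite (hdim_kronecker_form _ (kronecker_SkewI mu k_gt0)).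
by rewrite !big_cons big_nil !hdim_IJ_jordan; case: eqP => _; lia.
Qed.

Lemma hdim_SkewI_infinity k (mu : F) m : (0 < k)%N ->
  hdim (skew_pair (SkewI k mu)) (kron_pair (KronIJ m 0)) = 0%N.
Proof.
move=> k_gt0; rewrite (hdim_kronecker_form _ (kronecker_SkewI mu k_gt0)).
by rewrite !big_cons big_nil !hdim_IJ_infinity.
Qed.

Lemma hdim_SkewI_FG k (mu : F) m : (0 < k)%N ->
  hdim (skew_pair (SkewI k mu)) (kron_pair (KronFG F m)) = 0%N.
Proof.
move=> k_gt0; rewrite (hdim_kronecker_form _ (kronecker_SkewI mu k_gt0)).
by rewrite !big_cons big_nil !hdim_IJ_FG.
Qed.

Lemma skew_even_odd n : (0 < n)%N ->
  (exists2 k, (0 < k)%N & n = (2 * k)%N) \/ (exists k, n = (2 * k + 1)%N).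
Proof.
move=> n_gt0; have [odd_n|even_n] := boolP (odd n); [right|left].
  by exists n./2; lia.
by exists n./2; lia.
Qed.

Lemma hdim_SkewII_jordan n m lambda : (0 < n)%N ->
  hdim (skew_pair (SkewII F n)) (test_jordan m lambda) = (odd n * m)%N.
Proof.
case/skew_even_odd => [[k k_gt0 ->]|[k ->]].
  rewrite (hdim_kronecker_form _ (kronecker_SkewII_even F k_gt0)).
  by rewrite !big_cons big_nil !hdim_JI_jordan; lia.
rewrite (hdim_kronecker_form _ (kronecker_SkewII_odd F k)) !big_cons big_nil.
by rewrite hdim_FG_jordan hdim_FGT_row_free ?row_free1 //; lia.
Qed.

Lemma hdim_SkewII_infinity n m : (0 < n)%N ->
  hdim (skew_pair (SkewII F n)) (kron_pair (KronIJ m 0)) =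
  (if odd n then m else 2 * minn n./2 m)%N.
Proof.
case/skew_even_odd => [[k k_gt0 ->]|[k ->]].
  rewrite (hdim_kronecker_form _ (kronecker_SkewII_even F k_gt0)).
  by rewrite !big_cons big_nil !hdim_JI_infinity mul2n odd_double doubleK; lia.
rewrite (hdim_kronecker_form _ (kronecker_SkewII_odd F k)) !big_cons big_nil.
by rewrite hdim_FG_infinity hdim_FGT_infinity addn1 mul2n /= odd_double /=; lia.
Qed.

Lemma hdim_SkewII_FG n m : (0 < n)%N ->
  hdim (skew_pair (SkewII F n)) (kron_pair (KronFG F m)) = (odd n * (m - n./2))%N.
Proof.
case/skew_even_odd => [[k k_gt0 ->]|[k ->]].
  rewrite (hdim_kronecker_form _ (kronecker_SkewII_even F k_gt0)).
  by rewrite !big_cons big_nil !hdim_JI_FG; lia.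
rewrite (hdim_kronecker_form _ (kronecker_SkewII_odd F k)) !big_cons big_nil.
by rewrite hdim_FG_FG hdim_FGT_row_free ?row_free_G //; lia.
Qed.

Lemma skew_form_unique s s' :
  all (@skew_index_valid F) s -> all (@skew_index_valid F) s' ->
  (forall T, \sum_(b <- s) hdim (skew_pair b) T =
             \sum_(b <- s') hdim (skew_pair b) T)%N ->
  perm_eq s s'.
Proof.
move=> ok ok' eT; apply/allP => b0; rewrite mem_cat => b0_in.
have {b0_in} ok0 : skew_index_valid b0 by case/orP: b0_in; apply/allP.
have e2 T T' : (\sum_(b <- s) (hdim (skew_pair b) T + hdim (skew_pair b) T') =
                \sum_(b <- s') (hdim (skew_pair b) T + hdim (skew_pair b) T'))%N.
  by rewrite !big_split /= !eT.
apply/eqP; case: b0 ok0 => [k lambda|n] /= ok0.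
  (* In [m], [minn j m] is concave with its only kink at [m = j]; the two equal Kronecker blocks
     double the jump. *)
  apply: (skew_index_count _ _ ok ok' (e2 (test_jordan k.+1 lambda) (test_jordan k.-1 lambda))
    (e2 (test_jordan k lambda) (test_jordan k lambda)) (w := 2)) => //.
  case=> [j mu|j] /= ok_b; last by rewrite !hdim_SkewII_jordan //; lia.
  rewrite !hdim_SkewI_jordan //.
  have -> : (SkewI j mu == SkewI k lambda) = (j == k) && (mu == lambda) by [].
  by case: (mu == lambda); rewrite ?andbT ?andbF; lia.
have eqII j : (SkewII F j == SkewII F n) = (j == n) by [].
have [[k k_gt0 nE]|[k nE]] := skew_even_odd ok0.
  apply: (skew_index_count _ _ ok ok'
    (e2 (kron_pair (KronIJ k.+1 0)) (kron_pair (KronIJ k.-1 0)))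
    (e2 (kron_pair (KronIJ k 0)) (kron_pair (KronIJ k 0))) (w := 2)) => //.
  case=> [j mu|j] /= ok_b; first by rewrite !hdim_SkewI_infinity.
  by rewrite !hdim_SkewII_infinity // eqII; case: ifP; lia.
(* The truncated [m - j./2] is convex, so the two sides change places; only the block [(F, G)]
   contributes, hence weight 1. For [k = 0] the index [k.-1] is 0 again and the identity still
   holds. *)
apply: (skew_index_count _ _ ok ok'
  (e2 (kron_pair (KronFG F k)) (kron_pair (KronFG F k)))
  (e2 (kron_pair (KronFG F k.+1)) (kron_pair (KronFG F k.-1))) (w := 1)) => //.
case=> [j mu|j] /= ok_b; first by rewrite !hdim_SkewI_FG.
by rewrite !hdim_SkewII_FG // eqII; lia.
Qed.

End Uniqueness.

Theorem theorem5p1 (F : closedFieldType) (charF : 2%N \notin [pchar F]) :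
  (* (a) existence and uniqueness up to permutation of summands *)
  (forall (n : nat) (A B : 'M[F]_n), A^T = - A -> B^T = - B ->
     exists s : seq (skew_index F),
       skew_form (SqPair A B) s /\
       (forall s' : seq (skew_index F),
          skew_form (SqPair A B) s' -> perm_eq s s'))
  /\
  (* (b) the Kronecker canonical form determines the direct sum *)
  (forall (n n' : nat) (A B : 'M[F]_n) (A' B' : 'M[F]_n')
          (c c' : seq (kron_index F)) (s s' : seq (skew_index F)),
     A^T = - A -> B^T = - B -> A'^T = - A' -> B'^T = - B' ->
     kronecker_form (SqPair A B) c -> kronecker_form (SqPair A' B') c' ->
     perm_eq c c' ->
     skew_form (SqPair A B) s -> skew_form (SqPair A' B') s' ->
     perm_eq s s')
  /\
  (* (b) Kronecker canonical forms of the summands *)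
  (forall (k : nat) (lambda : F), (0 < k)%N ->
     kronecker_form (skew_pair (SkewI k lambda))
       [:: KronIJ k lambda; KronIJ k lambda])
  /\
  (forall k : nat,
     kronecker_form (skew_pair (SkewII F (2 * k + 1)))
       [:: KronFG F k; KronFGT F k])
  /\
  (forall k : nat, (0 < k)%N ->
     kronecker_form (skew_pair (SkewII F (2 * k)))
       [:: KronJI F k; KronJI F k]).
Proof.
have two_neq0 : 2%:R != 0 :> F by move: charF; rewrite inE.
split=> [n A B skA skB|].
  have [s form_s] := skew_form_exists two_neq0 skA skB.
  exists s; split=> // s' form_s'.
  apply: skew_form_unique (proj1 form_s) (proj1 form_s') _ => T.
  by rewrite -(hdim_skew_form T form_s) -(hdim_skew_form T form_s').
split=> [n n' A B A' B' c c' s s' _ _ _ _ kron_c kron_c' cc' form_s form_s'|].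
  apply: skew_form_unique (proj1 form_s) (proj1 form_s') _ => T.
  rewrite -(hdim_skew_form T form_s) -(hdim_skew_form T form_s').
  rewrite (hdim_kronecker_form T kron_c) (hdim_kronecker_form T kron_c').
  exact: perm_big.
split; first exact: kronecker_SkewI.
split; first exact: kronecker_SkewII_odd.
exact: kronecker_SkewII_even.
Qed.
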